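(* Let $n\ge1$, $C\in\mathbb{R}$, and consider the reduced LR system for the standard metric, i.e. the Hamiltonian system on $\mathbb{R}^{4n}=\{(q,p)\}$, $q=(x_1,\dots,x_n,y_1,\dots,y_n)$, $p=(p_1,\dots,p_{2n})$, with Hamiltonian $$H_C(q,p)=\frac12\Big(\langle p,p\rangle-\frac{\omega(q,p)^2}{1+\langle q,q\rangle}\Big)$$ and Poisson brackets ($k,j=1,\dots,n$) $\{x_k,p_j\}=\{y_k,p_{n+j}\}=\delta_{kj}$, $\{p_k,p_{n+j}\}=C\,\delta_{kj}$, all other brackets of coordinate functions (up to antisymmetry) being zero. This system is Liouville integrable for $n=1,2$. For $n\ge3$, it is integrable in the non-commutative sense and possesses $3n-2$ first integrals. In the hyperspherical coordinates $(r,\theta_1,\dots,\theta_{2n-1},p_r,p_{\theta_1},\dots,p_{\theta_{2n-1}})$, these first integrals are $$\tilde I_0=\tilde H_C,$$ $$\tilde I_1=p_{\theta_n}+\frac C2\,r^2\prod_{k=1}^{n-1}\cos^2\theta_k,$$ $$\tilde I_i=p_{\theta_{i+n-1}}+\frac C2\,r^2\prod_{k=1}^{n-i}\cos^2\theta_k\,\sin^2\theta_{n-i+1},\qquad 1<i\le n,$$ $$\tilde I_{n+1}=p_{\theta_{n-1}}^2-(p_{\theta_n}+p_{\theta_{n+1}})^2+p_{\theta_n}^2\cos^{-2}\theta_{n-1}+p_{\theta_{n+1}}^2\sin^{-2}\theta_{n-1}\qquad(n\ge2),$$ $$\tilde I_{n+i}=\Big(p_{\theta_n}\prod_{k=1}^{i-1}\cos^{-1}\theta_{n-k}\,\tan\theta_{n-i}-p_{\theta_{n+i}}\prod_{k=1}^{i-1}\cos\theta_{n-k}\,\cot\theta_{n-i}\Big)^2+\Big(p_{\theta_{n-i}}\prod_{k=1}^{i-1}\cos\theta_{n-k}+\varrho_{i}\tan\theta_{n-i}\Big)^2,\qquad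 1<i<n,$$ where $\varrho_0=0$ and $\varrho_i=p_{\theta_{n-i}}\sin\theta_{n-i}\prod_{k=1}^{i-1}\cos\theta_{n-k}+\cos^{-1}\theta_{n-i}\;\varrho_{i-1}$, together with $$\tilde J_k=\{\tilde I_{n+1},\tilde I_{n+k}\},\qquad 1<k<n.$$ Here $\tilde H_C$ denotes $H_C$ expressed in the hyperspherical coordinates.
   Context: Notation: $\omega(a,b)=a^TJb$ with $J=\begin{pmatrix} 0 & -E \\ E & 0 \end{pmatrix}$, $E$ the $n\times n$ identity; $\langle\cdot,\cdot\rangle$ is the standard inner product on $\mathbb{R}^{2n}$. Empty products equal $1$. The dynamics is $\dot f=\{f,H_C\}$. (This system is the reduction at $\lambda_{2n+1}=C$ of the normal sub-Riemannian geodesic flow on the Heisenberg group with metric $\sum_k(dx_k^2+dy_k^2)+(dz-\sum_kx_kdy_k)^2$ restricted to the right-invariant distribution spanned by $\partial_{x_k}+y_k\partial_z$, $\partial_{y_k}$; with $\lambda_i$ the canonical momenta, $p_k=\lambda_k+Cy_k$, $p_{n+k}=\lambda_{n+k}$.) Hyperspherical coordinates on $\mathbb{R}^{2n}$: $x_1=r\prod_{j=1}^{n-1}\cos\theta_j\,\cos\theta_n$, $y_1=r\prod_{j=1}^{n-1}\cos\theta_j\,\sin\theta_n$, and for $k=2,\dots,n$: $x_k=r\prod_{j=1}^{n-k}\cos\theta_j\,\sin\theta_{n-k+1}\cos\theta_{n+k-1}$, $y_k=r\prod_{j=1}^{n-k}\cos\theta_j\,\sin\theta_{n-k+1}\sin\theta_{n+k-1}$.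 The associated momenta are $p_r=\sum_{i=1}^{2n}p_i\,\partial q_i/\partial r$ and $p_{\theta_j}=\sum_{i=1}^{2n}p_i\,\partial q_i/\partial\theta_j$. Integrability: on a symplectic (nondegenerate Poisson) manifold $S$ with Poisson tensor $\Lambda$, a first integral of the Hamiltonian system is a function $f$ with $\{f,H\}=0$, where $H$ is the Hamiltonian. For a Lie algebra $\mathcal{F}$ (under the Poisson bracket) of first integrals let $F_x=\{df_x: f\in\mathcal{F}\}\subset T_x^*S$, and assume that $\dim F_x$ and $\dim\ker(\Lambda_x|_{F_x})$ are constant on an open dense subset of $S$; these constants are denoted $\mathrm{ddim}\,\mathcal{F}$ and $\mathrm{dind}\,\mathcal{F}$. $\mathcal{F}$ is complete if $\mathrm{ddim}\,\mathcal{F}+\mathrm{dind}\,\mathcal{F}=\dim S$. The system is (completely) integrable in the non-commutative sense if it possesses a complete algebra of first integrals; it is Liouville integrable (integrable in the commutative sense) if it possesses a complete commutative algebra of first integrals, i.e. $\mathrm{ddim}\,\mathcal{F}=\mathrm{dind}\,\mathcal{F}=\frac12\dim S$.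
   Formalization: In the formula for Ĩ_{n+i} (1<i<n), the last term ϱ_i tan θ_{n-i} is replaced by ϱ_{i-1} tan θ_{n-i}, since with ϱ_i the function is not a first integral (e.g. n=3, i=2); the recursion for ϱ_i is unchanged. *)

(* Defs.v *)
From HB Require Import structures.
From mathcomp Require Import all_boot all_order all_algebra.
From mathcomp Require Import all_classical all_reals all_analysis.

Set Implicit Arguments.
Unset Strict Implicit.
Unset Printing Implicit Defensive.

Import Order.TTheory GRing.Theory Num.Theory.
Import numFieldNormedType.Exports.

Local Open Scope classical_set_scope.
Local Open Scope ring_scope.

(* Hamiltonian systems on R^N with a Poisson tensor L, in global coordinates;
   [L x a b] is the bracket of the coordinate functions a and b at x. *)
Section Integrability.
Variables (R : realType) (N : nat).
Implicit Types (f g H : 'rV[R]_N -> R) (L : 'rV[R]_N -> 'M[R]_N)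
  (F : set ('rV[R]_N -> R)) (x : 'rV[R]_N).

Definition partial (i : 'I_N) f x : R := 'D_(delta_mx 0 i) f x.

Definition grad f x : 'rV[R]_N := \row_i partial i f x.

(* C^infinity: every iterated partial derivative is differentiable, hence
   in particular continuous. *)
Definition smooth f : Prop :=
  forall (s : seq 'I_N) x, differentiable (foldr partial f s) x.

Definition bracket L f g x : R :=
  (grad f x *m L x *m (grad g x)^T) 0 0.

Definition first_integral L H f : Prop :=
  smooth f /\ forall x, bracket L f H x = 0.

Definition lie_closed L F : Prop :=
  [/\ F (fun=> 0),
      forall (a : R) f g, F f -> F g -> F (fun x => a * f x + g x) &
      forall f g, F f -> F g -> F (bracket L f g)].

Definition first_integral_algebra L H F : Prop :=
  lie_closed L F /\ forall f, F f -> first_integral L H f.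

(* The spaces F_x and ker (L_x restricted to F_x); covectors are written as
   row vectors of components. *)
Definition codist F x : set 'rV[R]_N := [set grad f x | f in F].

Definition codist_ker L F x : set 'rV[R]_N :=
  [set u | codist F x u /\
           forall v, codist F x v -> (u *m L x *m v^T) 0 0 = 0].

Definition has_dim (A : set 'rV[R]_N) (d : nat) : Prop :=
  exists2 U : {vspace 'rV[R]_N}, (forall v, A v <-> v \in U) & \dim U = d.

Definition generically (P : 'rV[R]_N -> Prop) : Prop :=
  exists U : set 'rV[R]_N, [/\ open U, dense U & forall x, U x -> P x].

Definition is_ddim F (d : nat) : Prop :=
  generically (fun x => has_dim (codist F x) d).

Definition is_dind L F (d : nat) : Prop :=
  generically (fun x => has_dim (codist_ker L F x) d).

Definition complete_algebra L H F : Prop :=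
  first_integral_algebra L H F /\
  exists k l : nat, [/\ is_ddim F k, is_dind L F l & (k + l)%N = N].

Definition commutative_algebra L F : Prop :=
  forall f g, F f -> F g -> forall x, bracket L f g x = 0.

Definition nc_integrable L H : Prop :=
  exists F, complete_algebra L H F.

Definition liouville_integrable L H : Prop :=
  exists F, complete_algebra L H F /\ commutative_algebra L F.

Definition lie_generated L (G : set ('rV[R]_N -> R)) :
    set ('rV[R]_N -> R) :=
  smallest (lie_closed L) G.

Definition generically_independent (s : seq ('rV[R]_N -> R)) : Prop :=
  generically (fun x => free [seq grad f x | f <- s]).

End Integrability.

(* The reduced system.  A point of the phase space is row_mx q p with
   q = (x_1, ..., x_n, y_1, ..., y_n) and p = (p_1, ..., p_2n). *)
Section ReducedSystem.
Variables (R : realType) (n : nat).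

Definition dot (m : nat) (a b : 'rV[R]_m) : R := (a *m b^T) 0 0.

Definition Jmx : 'M[R]_(n + n) := block_mx 0 (- 1%:M) 1%:M 0.

Definition omega (a b : 'rV[R]_(n + n)) : R := (a *m Jmx *m b^T) 0 0.

Definition HC (z : 'rV[R]_((n + n) + (n + n))) : R :=
  let q := lsubmx z in
  let p := rsubmx z in
  2^-1 * (dot p p - omega q p ^+ 2 / (1 + dot q q)).

Definition LR_poisson (C : R) (_ : 'rV[R]_((n + n) + (n + n))) :
    'M[R]_((n + n) + (n + n)) :=
  block_mx 0 1%:M (- 1%:M) (block_mx 0 C%:M (- C%:M) 0).

End ReducedSystem.

Lemma LR_poisson_antisym (R : realType) (n : nat) (C : R) z :
  (LR_poisson (n := n) C z)^T = - LR_poisson C z.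
Proof.
rewrite /LR_poisson !tr_block_mx !opp_block_mx.
by rewrite !raddfN /= !trmx0 !trmx1 !tr_scalar_mx !oppr0 !opprK.
Qed.

Lemma LR_poisson_nondegenerate (R : realType) (n : nat) (C : R) z :
  LR_poisson (n := n) C z \in unitmx.
Proof.
pose B : 'M[R]_(n + n) := block_mx 0 C%:M (- C%:M) 0.
suff /mulmx1_unit[] : LR_poisson C z *m block_mx B (- 1%:M) 1%:M 0 = 1%:M.
  by [].
rewrite /LR_poisson mulmx_block -/B !(mul0mx, mulmx0, mul1mx, mulmx1).
rewrite !mulNmx !mul1mx !(add0r, addr0) opprK addNr.
by rewrite -scalar_mx_block.
Qed.

(* Hyperspherical coordinates r, theta_1, ..., theta_(2n-1).  The angles are
   given by a sequence theta : nat -> R of which only the entries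
   1, ..., 2n - 1 are used, so that indices agree with the usual ones. *)
Section Hyperspherical.
Variables (R : realType) (n : nat).
Implicit Types (r : R) (theta : nat -> R).

(* the polar radius of the pair (x_k, y_k), whose polar angle is
   theta_(n+k-1) *)
Definition hs_rad (k : nat) r theta : R :=
  if (k == 1)%N then r * \prod_(1 <= j < n) cos (theta j)
  else r * (\prod_(1 <= j < (n - k).+1) cos (theta j))
         * sin (theta (n - k + 1)%N).

Definition hs_q r theta : 'rV[R]_(n + n) :=
  row_mx (\row_(k < n) (hs_rad k.+1 r theta * cos (theta (n + k)%N)))
         (\row_(k < n) (hs_rad k.+1 r theta * sin (theta (n + k)%N))).

Definition hs_ptheta r theta (p : 'rV[R]_(n + n)) (j : nat) : R :=
  \sum_(i < n + n) p 0 i *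
    derive1 (fun t => hs_q r [eta theta with j |-> t] 0 i) (theta j).

Definition hs_regular r theta : Prop :=
  0 < r /\ forall j, (1 <= j < n)%N -> cos (theta j) != 0 /\ sin (theta j) != 0.

(* f, a function on phase space, has the expression E in hyperspherical
   coordinates; E takes r, (theta_j) and (p_theta_j) *)
Definition hs_expr (f : 'rV[R]_((n + n) + (n + n)) -> R)
    (E : R -> (nat -> R) -> (nat -> R) -> R) : Prop :=
  forall r theta (p : 'rV[R]_(n + n)), hs_regular r theta ->
    f (row_mx (hs_q r theta) p) = E r theta (hs_ptheta r theta p).

Implicit Type pt : nat -> R.

Fixpoint varrho (i : nat) theta pt : R :=
  if i is i'.+1 then
    pt (n - i)%N * sin (theta (n - i)%N)
      * (\prod_(1 <= k < i) cos (theta (n - k)%N))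
    + (cos (theta (n - i)%N))^-1 * varrho i' theta pt
  else 0.

Definition tildeI_first (C : R) r theta pt : R :=
  pt n + C / 2 * r ^+ 2 * \prod_(1 <= k < n) cos (theta k) ^+ 2.

Definition tildeI_angular (C : R) (i : nat) r theta pt : R :=
  pt (i + n - 1)%N
  + C / 2 * r ^+ 2 * (\prod_(1 <= k < (n - i).+1) cos (theta k) ^+ 2)
    * sin (theta (n - i + 1)%N) ^+ 2.

Definition tildeI_base (r : R) theta pt : R :=
  pt (n - 1)%N ^+ 2 - (pt n + pt (n + 1)%N) ^+ 2
  + pt n ^+ 2 * cos (theta (n - 1)%N) ^- 2
  + pt (n + 1)%N ^+ 2 * sin (theta (n - 1)%N) ^- 2.

(* The last factor is varrho_(i-1).  The published formula has varrho_i there,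
   an off-by-one misprint: r_1 p_(r_(i+1)) - r_(i+1) p_(r_1), where
   r_k = hs_rad k, equals the second square's base with varrho_(i-1), whereas
   the function obtained with varrho_i does not commute with HC. *)
Definition tildeI_pair (i : nat) (r : R) theta pt : R :=
  (pt n * (\prod_(1 <= k < i) (cos (theta (n - k)%N))^-1)
     * tan (theta (n - i)%N)
   - pt (n + i)%N * (\prod_(1 <= k < i) cos (theta (n - k)%N))
     * (tan (theta (n - i)%N))^-1) ^+ 2
  + (pt (n - i)%N * (\prod_(1 <= k < i) cos (theta (n - k)%N))
     + varrho i.-1 theta pt * tan (theta (n - i)%N)) ^+ 2.

End Hyperspherical.

(* Main.v *)
Require Import Defs.
From HB Require Import structures.
From mathcomp Require Import all_boot all_order all_algebra perm.
From mathcomp Require Import all_classical all_reals all_analysis.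
From mathcomp Require Import ring zify.

Set Implicit Arguments.
Unset Strict Implicit.
Unset Printing Implicit Defensive.

Import Order.TTheory GRing.Theory Num.Theory.
Import numFieldNormedType.Exports.

Local Open Scope classical_set_scope.
Local Open Scope ring_scope.

(** Write [z_k = x_k + i y_k] and [w_k = A_k + i B_k], where
    [A_k = a_k - C/2 y_k] and [B_k = b_k + C/2 x_k] are momenta corrected by a
    vector potential of the magnetic term.  In the coordinates (x, y, A, B) the
    bracket is the canonical one, and [HC] becomes a function of |z|^2, |w|^2
    and omega(z, w).  These three functions, and the dot product of [z] and [w],
    are invariant under the diagonal action of U(n); so everything built from
    the moment map of that action is a first integral.  The moment map has
    entries z_j conj(w_k) - w_j conj(z_k).  Its diagonal gives the angular
    momenta [angmom k] (the integrals linear in the momenta), and, up to sign,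
    its principal 2x2 minors are the numbers |z_j w_k - z_k w_j|^2; those with
    j = 0 are the functions [sqminor k].

    Let F be the Lie algebra generated by all the integrals.  It consists of
    functions that commute with [HC], with all the angular momenta (all its
    elements are invariant under the diagonal torus), and with the Casimir
    function |z|^2 |w|^2 - (z . w)^2 - omega(z, w)^2 of the moment map: by the
    Jacobi identity it suffices to check this on generators.  For n >= 2 that
    is a family of n + 2 commuting functions, while there are 3n - 2
    generators, and (n + 2) + (3n - 2) = 4n is the dimension of the phase
    space.  So, as soon as each of the two families has independent
    differentials, linear algebra forces the differentials of F to be exactly
    the span of those of the generators, and the kernel of the Poisson tensor on
    this span to be the span of those of the commuting family
    ([complete_of_center]).  In particular no bracket of generators has to be
    computed in closed form.  For n = 1 the two families are both formed by
    [HC] and the angular momentum.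

    All functions involved are rational without real singularities
    ([regular]).  For such functions partial derivatives commute by structural
    induction, which gives the Jacobi identity [bracket_jacobi], and
    independence at one point gives independence on an open dense set
    ([regular_generically_independent]), because a nonzero rational function
    cannot vanish on an open set.  A convenient point is z = (1, 0, ..., 0),
    w = (1, ..., 1), where the Jacobian matrix, tested with the Hamiltonian
    fields of |z|^2 and of single coordinates, is triangular ([free_integrals],
    [free_center]).

    The hyperspherical formulas follow from z_k = rho_k exp(i phi_k), in which
    |z_0 w_k - z_k w_0|^2 is the sum of the squares of
    rho_0 p_(rho_k) - rho_k p_(rho_0) and of
    rho_0 l_k / rho_k - rho_k l_0 / rho_0, where l_k is the angular momentum
    without its magnetic part.  The remaining point is to recover the first of
    these from the momenta p_theta; the auxiliary sequence [varrho] does this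
    by a telescoping recursion, solved in [varrhoE]. *)

(** * Nowhere singular rational functions *)

Section RegularFunctions.
Variables (R : realType) (N : nat).
Notation V := 'rV[R]_N.
Implicit Types (f g h : V -> R) (x v : V) (i j : 'I_N).

(** These are the rational functions whose denominator has no real zero. *)
Inductive regular : (V -> R) -> Prop :=
| regular_cst c : regular (cst c)
| regular_coord i : regular (fun x => x 0 i)
| regularD f g : regular f -> regular g -> regular (f + g)
| regularM f g : regular f -> regular g -> regular (f * g)
| regularV f : regular f -> (forall x, f x != 0) ->
    regular (fun x => (f x)^-1).

Lemma regularN f : regular f -> regular (- f).
Proof.
move=> fr; have -> : - f = cst (-1) * f.
  by apply/funext => x; rewrite !fctE mulN1r.
exact/regularM/fr/regular_cst.
Qed.

Lemma regular0 : regular 0.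
Proof. exact: (regular_cst 0). Qed.

Lemma regular1 : regular 1.
Proof. exact: (regular_cst 1). Qed.

Lemma regularMn f k : regular f -> regular (f *+ k).
Proof.
move=> fr; elim: k => [|k IH]; first exact: regular0.
by rewrite mulrS; exact: regularD.
Qed.

Lemma regular_sum (I : Type) (r : seq I) (P : pred I) (F : I -> V -> R) :
  (forall a, P a -> regular (F a)) -> regular (\sum_(a <- r | P a) F a).
Proof. by move=> Fr; elim/big_ind: _ => //; [exact: regular0|exact: regularD]. Qed.

Lemma regular_prod (I : Type) (r : seq I) (P : pred I) (F : I -> V -> R) :
  (forall a, P a -> regular (F a)) -> regular (\prod_(a <- r | P a) F a).
Proof. by move=> Fr; elim/big_ind: _ => //; [exact: regular1|exact: regularM]. Qed.

Lemma regular_differentiable f x : regular f -> differentiable f x.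
Proof.
elim=> [c|i|{}f g _ fd _ gd|{}f g _ fd _ gd|{}f _ fd fn0].
- exact: differentiable_cst.
- exact: differentiable_coord.
- exact: differentiableD.
- exact: differentiableM.
- exact: differentiableV.
Qed.

Lemma regular_derivable f x v : regular f -> derivable f x v.
Proof. by move=> fr; apply/diff_derivable/regular_differentiable. Qed.

Lemma partial_cst i c : partial i (cst c : V -> R) = 0.
Proof. by apply/funext => x; rewrite /partial derive_cst. Qed.

Lemma partial0 i : partial i (0 : V -> R) = 0.
Proof. exact: (partial_cst i 0). Qed.

Lemma partial_coord i j :
  partial i (fun x : V => x 0 j) = cst ((i == j)%:R).
Proof.
apply/funext => x; rewrite /partial deriveE; last exact: differentiable_coord.
have @f : {linear V -> R}.
  by exists (fun N : V => N 0 j); do 2![eexists]; do ?[constructor];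
     rewrite ?mxE// => ? *; rewrite ?mxE//; move=> ?; rewrite !mxE.
rewrite (_ : (fun _ => _) = f) // diff_lin /=; last first.
  exact: coord_continuous.
by rewrite mxE eqxx eq_sym.
Qed.

Lemma partialD i f g : regular f -> regular g ->
  partial i (f + g) = partial i f + partial i g.
Proof.
by move=> fr gr; apply/funext => x; rewrite /partial deriveD //;
  exact: regular_derivable.
Qed.

Lemma partialM i f g : regular f -> regular g ->
  partial i (f * g) = f * partial i g + g * partial i f.
Proof.
by move=> fr gr; apply/funext => x; rewrite /partial deriveM //;
  exact: regular_derivable.
Qed.

Lemma partialV i f : regular f -> (forall x, f x != 0) ->
  partial i (fun x => (f x)^-1) =
    - ((fun x => (f x)^-1) * (fun x => (f x)^-1) * partial i f).
Proof.
move=> fr fn0; apply/funext => x; rewrite /partial deriveV //; last first.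
  exact: regular_derivable.
by rewrite !fctE expr2 invfM; exact: mulNr.
Qed.

Lemma partialN i f : regular f -> partial i (- f) = - partial i f.
Proof.
move=> fr; apply/funext => x; rewrite /partial deriveN //.
exact: regular_derivable.
Qed.

#[local] Opaque partial.

Lemma regular_partial i f : regular f -> regular (partial i f).
Proof.
elim=> [c|j|{}f g fr dfr gr dgr|{}f g fr dfr gr dgr|{}f fr dfr fn0].
- by rewrite partial_cst; exact: regular0.
- by rewrite partial_coord; exact: regular_cst.
- by rewrite partialD //; exact: regularD.
- by rewrite partialM //; apply: regularD; exact: regularM.
- rewrite partialV //; apply/regularN/regularM => //.
  by apply: regularM; exact: regularV.
Qed.

Lemma regular_smooth f : regular f -> smooth f.
Proof.
move=> fr s x; apply: regular_differentiable.
by elim: s => //= i s IH; exact: regular_partial.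
Qed.

(** Second partial derivatives commute: this is immediate on constants and
    coordinates, and the Leibniz and quotient rules propagate it. *)
Lemma partialC i j f : regular f ->
  partial i (partial j f) = partial j (partial i f).
Proof.
elim=> [c|k|{}f g fr fC gr gC|{}f g fr fC gr gC|{}f fr fC fn0].
- by rewrite !partial_cst ?partial0.
- by rewrite !partial_coord !partial_cst.
- have [dif djf] := (regular_partial i fr, regular_partial j fr).
  have [dig djg] := (regular_partial i gr, regular_partial j gr).
  rewrite (partialD j fr gr) (partialD i fr gr).
  by rewrite (partialD i djf djg) (partialD j dif dig) fC gC.
- have [dif djf] := (regular_partial i fr, regular_partial j fr).
  have [dig djg] := (regular_partial i gr, regular_partial j gr).
  have [r1 r2] := (regularM fr djg, regularM gr djf).
  have [r3 r4] := (regularM fr dig, regularM gr dif).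
  rewrite (partialM j fr gr) (partialM i fr gr).
  rewrite (partialD i r1 r2) (partialD j r3 r4).
  rewrite (partialM i fr djg) (partialM i gr djf).
  rewrite (partialM j fr dig) (partialM j gr dif) fC gC.
  generalize (partial j (partial i f)) (partial j (partial i g)).
  generalize (partial i f) (partial j f) (partial i g) (partial j g) => *.
  ring.
- have rV := regularV fr fn0.
  have [dir djr] := (regular_partial i fr, regular_partial j fr).
  have V2r := regularM rV rV.
  have [r1 r2] := (regularM V2r dir, regularM V2r djr).
  rewrite (partialV j fr fn0) (partialV i fr fn0).
  rewrite (partialN i r2) (partialN j r1).
  rewrite (partialM i V2r djr) (partialM j V2r dir).
  rewrite (partialM i rV rV) (partialM j rV rV).
  rewrite (partialV j fr fn0) (partialV i fr fn0) fC.
  generalize (partial j (partial i f)) (partial i f) (partial j f) => *.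
  ring.
Qed.

(** Reduces the study of the zero set to one variable, where a nonzero
    numerator has finitely many zeros. *)
Lemma regular_line f x v : regular f ->
  exists P Q : {poly R}, (forall t, Q.[t] != 0) /\
    forall t : R, f (x + t *: v) = P.[t] / Q.[t].
Proof.
elim=> [c|i|{}f g _ [P [Q [Q0 fE]]] _ [P' [Q' [Q'0 gE]]]
           |{}f g _ [P [Q [Q0 fE]]] _ [P' [Q' [Q'0 gE]]]
           |{}f _ [P [Q [Q0 fE]]] fn0].
- exists c%:P, 1; split=> [t|t]; rewrite !hornerE ?oner_eq0 //.
  by rewrite invr1 mulr1.
- exists ((x 0 i)%:P + (v 0 i)%:P * 'X), 1; split=> [t|t];
    rewrite !hornerE ?oner_eq0 //.
  by rewrite invr1 mulr1 !mxE mulrC.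
- exists (P * Q' + P' * Q), (Q * Q'); split=> t; rewrite !hornerE.
    by rewrite mulf_neq0.
  by rewrite !fctE fE gE addf_div.
- exists (P * P'), (Q * Q'); split=> t; rewrite !hornerE.
    by rewrite mulf_neq0.
  by rewrite !fctE fE gE mulf_div.
- exists Q, P; split=> t; last by rewrite fE invf_div.
  by have := fn0 (x + t *: v); rewrite fE mulf_eq0 negb_or => /andP[].
Qed.

(** A rational function of one real variable that vanishes near a point
    vanishes identically, so on the line through a given point and a point
    where [f] is nonzero there are nonzeros of [f] arbitrarily close to the
    given point. *)
Lemma regular_nonzero_dense f x0 : regular f -> f x0 != 0 ->
  open [set x | f x != 0] /\ dense [set x | f x != 0].
Proof.
move=> fr fx0; split.
  apply: (@open_comp _ _ f [set y | y != 0]) => [x _|].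
    exact/differentiable_continuous/regular_differentiable.
  exact: open_neq.
move=> O [x Ox] Oo.
have [P [Q [Q0 fE]]] := regular_line x (x0 - x) fr.
have P1 : P.[1] != 0.
  by move: fx0; have := fE 1; rewrite scale1r addrCA subrr addr0 => ->;
    rewrite mulf_eq0 negb_or => /andP[].
have Pn0 : P != 0 by apply: contra_neq P1 => ->; rewrite horner0.
have cl : (fun t : R => x + t *: (x0 - x)) t @[t --> (0 : R)] --> x.
  suff : (fun t : R => x + t *: (x0 - x)) t @[t --> (0 : R)]
           --> x + 0 *: (x0 - x) by rewrite scale0r addr0.
  by apply: cvgD; [exact: cvg_cst|apply: cvgZr_tmp; exact: cvg_id].
have /cl : nbhs x O by exact: open_nbhs_nbhs.
move=> /nbhs_ballP[e /= e0 eO].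
(* the candidates e/2, e/3, ... are too many to be all roots of P *)
pose s := [seq e / (k.+2)%:R | k <- iota 0 (size P)].
have us : uniq s.
  rewrite map_inj_uniq ?iota_uniq // => a b /(mulfI (lt0r_neq0 e0)) /invr_inj.
  by move/eqP; rewrite eqr_nat => /eqP[].
have /allPn[t /mapP[k _ tE] Pt] : ~~ all (root P) s.
  apply/negP => /max_poly_roots -/(_ Pn0 us).
  by rewrite size_map size_iota ltnn.
exists (x + t *: (x0 - x)); split; last first.
  by rewrite /= fE mulf_neq0 ?invr_neq0.
apply: eO; rewrite /ball /= sub0r normrN tE gtr0_norm ?divr_gt0 //.
by rewrite ltr_pdivrMr // ltr_pMr // ltr1n.
Qed.

End RegularFunctions.

#[export] Hint Resolve regular_cst regular_coord regularD regularM regularN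
  regular0 regular1 regularMn regular_partial : core.

(** * Poisson brackets with constant coefficients *)

Section ConstantPoisson.
Variables (R : realType) (N : nat) (L : 'rV[R]_N -> 'M[R]_N).
Hypothesis L_const : forall x, L x = L 0.
Hypothesis L_antisym : forall x, (L x)^T = - L x.
Notation V := 'rV[R]_N.
Notation "{[ f , g ]}" := (bracket L f g) (format "{[ f ,  g ]}").
Implicit Types (f g h : V -> R) (x : V) (i j : 'I_N).

Lemma bracketE f g x :
  {[f, g]} x = \sum_i \sum_j partial i f x * L x i j * partial j g x.
Proof.
rewrite /bracket mxE exchange_big /=; apply: eq_bigr => j _.
rewrite !mxE mulr_suml; apply: eq_bigr => i _.
by rewrite !mxE.
Qed.

Lemma bracket_fctE f g : {[f, g]} =
  \sum_i \sum_j partial i f * cst (L 0 i j) * partial j g.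
Proof.
apply/funext => x; rewrite bracketE fct_sumE; apply: eq_bigr => i _.
by rewrite fct_sumE; apply: eq_bigr => j _; rewrite L_const.
Qed.

Lemma regular_bracket f g : regular f -> regular g -> regular {[f, g]}.
Proof.
move=> fr gr; rewrite bracket_fctE; apply: regular_sum => i _.
apply: regular_sum => j _; apply: regularM; last exact: regular_partial.
by apply: regularM => //; exact: regular_partial.
Qed.

Lemma L_antisymE x i j : L x i j = - L x j i.
Proof. by have /(congr1 (fun M : 'M[R]_N => M j i)) := L_antisym x; rewrite !mxE. Qed.

Lemma bracketC f g : {[f, g]} = - {[g, f]}.
Proof.
apply/funext => x; rewrite !fctE !bracketE exchange_big -sumrN.
apply: eq_bigr => i _; rewrite -sumrN; apply: eq_bigr => j _.
by rewrite L_antisymE; ring.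
Qed.

Lemma bracket0C f g : {[f, g]} = 0 -> {[g, f]} = 0.
Proof. by move=> fg0; rewrite bracketC fg0 oppr0. Qed.

Lemma bracketff f : {[f, f]} = 0.
Proof.
apply/funext => x; have /(congr1 (fun u => u x)) := bracketC f f.
by move/eqP; rewrite -subr_eq0 opprK -mulr2n mulrn_eq0 => /eqP.
Qed.

Lemma bracketDl f g h : regular f -> regular g ->
  {[f + g, h]} = {[f, h]} + {[g, h]}.
Proof.
move=> fr gr; rewrite !bracket_fctE -big_split /=; apply: eq_bigr => i _.
rewrite -big_split /=; apply: eq_bigr => j _; rewrite partialD //.
by rewrite -!mulrDl.
Qed.

Lemma bracketMl f g h : regular f -> regular g ->
  {[f * g, h]} = f * {[g, h]} + g * {[f, h]}.
Proof.
move=> fr gr; rewrite !bracket_fctE !mulr_sumr -big_split /=.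
apply: eq_bigr => i _.
rewrite !mulr_sumr -big_split /=; apply: eq_bigr => j _; rewrite partialM //.
by rewrite !mulrDl !mulrA.
Qed.

Lemma bracket_cstl c h : {[cst c, h]} = 0.
Proof.
rewrite bracket_fctE big1 // => i _; rewrite big1 // => j _.
by rewrite partial_cst !mul0r.
Qed.

Lemma bracket_coord i j :
  {[fun x : V => x 0 i, fun x : V => x 0 j]} = cst (L 0 i j).
Proof.
apply/funext => x; rewrite bracketE L_const (bigD1 i) //= (bigD1 j) //= !big1.
- by rewrite !partial_coord !eqxx !addr0 mul1r mulr1.
- move=> k /negPf ki; rewrite big1 // => l _.
  by rewrite partial_coord ki !mul0r.
- by move=> l /negPf lj; rewrite (partial_coord R l j) lj mulr0.
Qed.

Lemma bracketVl f h : regular f -> (forall x, f x != 0) ->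
  {[fun x => (f x)^-1, h]} =
    - ((fun x => (f x)^-1) * (fun x => (f x)^-1) * {[f, h]}).
Proof.
move=> fr fn0; rewrite !bracket_fctE mulr_sumr -sumrN.
apply: eq_bigr => i _; rewrite mulr_sumr -sumrN; apply: eq_bigr => j _.
by rewrite partialV // !mulNr !mulrA.
Qed.

Lemma bracketNl f h : regular f -> {[- f, h]} = - {[f, h]}.
Proof.
move=> fr; rewrite !bracket_fctE -sumrN; apply: eq_bigr => i _.
by rewrite -sumrN; apply: eq_bigr => j _; rewrite partialN // !mulNr.
Qed.

Lemma bracketMnl f h k : regular f -> {[f *+ k, h]} = {[f, h]} *+ k.
Proof.
move=> fr; elim: k => [|k IH]; first by rewrite !mulr0n; exact: bracket_cstl.
by rewrite !mulrS bracketDl ?IH //; exact: regularMn.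
Qed.

Lemma bracket_suml (I : finType) (F : I -> V -> R) h :
  (forall a, regular (F a)) ->
  {[\sum_a F a, h]} = \sum_a {[F a, h]}.
Proof.
move=> Fr; elim: (index_enum I) => [|a r IH].
  by rewrite !big_nil; exact: bracket_cstl.
rewrite !big_cons bracketDl ?IH //.
by apply: regular_sum => b _; exact: Fr.
Qed.

Lemma bracketDr f g h : regular f -> regular g ->
  {[h, f + g]} = {[h, f]} + {[h, g]}.
Proof. by move=> fr gr; rewrite bracketC bracketDl // opprD -!(bracketC h). Qed.

Lemma bracketMr f g h : regular f -> regular g ->
  {[h, f * g]} = f * {[h, g]} + g * {[h, f]}.
Proof.
by move=> fr gr; rewrite bracketC bracketMl // opprD -!mulrN -!(bracketC h).
Qed.

Lemma bracket_cstr c h : {[h, cst c]} = 0.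
Proof. by rewrite bracketC bracket_cstl oppr0. Qed.

Lemma bracketNr f h : regular f -> {[h, - f]} = - {[h, f]}.
Proof. by move=> fr; rewrite bracketC bracketNl // -(bracketC h). Qed.

Lemma bracketMnr f h k : regular f -> {[h, f *+ k]} = {[h, f]} *+ k.
Proof. by move=> fr; rewrite bracketC bracketMnl // -mulNrn -bracketC. Qed.

Lemma bracket_sumr (I : finType) (F : I -> V -> R) h :
  (forall a, regular (F a)) ->
  {[h, \sum_a F a]} = \sum_a {[h, F a]}.
Proof.
move=> Fr; rewrite bracketC bracket_suml // -sumrN.
by apply: eq_bigr => a _; rewrite -bracketC.
Qed.

Lemma partial_sum (I : Type) (r : seq I) i (F : I -> V -> R) :
  (forall a, regular (F a)) ->
  partial i (\sum_(a <- r) F a) = \sum_(a <- r) partial i (F a).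
Proof.
move=> Fr; elim: r => [|a r IH]; first by rewrite !big_nil partial0.
rewrite !big_cons partialD ?IH //.
by apply: regular_sum => b _; exact: Fr.
Qed.

Definition hessian f x : 'M[R]_N := \matrix_(i, j) partial j (partial i f) x.

Lemma hessian_sym f x : regular f -> (hessian f x)^T = hessian f x.
Proof. by move=> fr; apply/matrixP => i j; rewrite !mxE partialC. Qed.

Lemma grad_bracket f g x : regular f -> regular g ->
  grad {[f, g]} x =
    grad f x *m L x *m hessian g x - grad g x *m L x *m hessian f x.
Proof.
move=> fr gr.
have d1 i := regular_partial i fr; have d2 i := regular_partial i gr.
have rc i j := regularM (d1 i) (regular_cst N (L 0 i j)).
have r1 i j := regularM (rc i j) (d2 j).
apply/rowP => k; rewrite !mxE bracket_fctE partial_sum; last first.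
  by move=> i; apply: regular_sum => j _.
under eq_bigr do rewrite partial_sum //.
rewrite fct_sumE.
under eq_bigr do rewrite fct_sumE.
rewrite [X in _ = X - _](_ : _ = \sum_i \sum_j
    partial i f x * L 0 i j * partial k (partial j g) x); last first.
  rewrite exchange_big; apply: eq_bigr => j _ /=.
  rewrite !mxE mulr_suml; apply: eq_bigr => i _.
  by rewrite !mxE L_const.
rewrite [X in _ = _ - X](_ : _ = \sum_i \sum_j
    - (partial k (partial i f) x * L 0 i j * partial j g x)); last first.
  apply: eq_bigr => i _; rewrite !mxE mulr_suml; apply: eq_bigr => j _.
  by rewrite !mxE L_const L_antisymE; ring.
rewrite -sumrB; apply: eq_bigr => i _; rewrite -sumrB; apply: eq_bigr => j _.
rewrite (partialM k (rc i j) (d2 j)) (partialM k (d1 i) (regular_cst N _)).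
rewrite partial_cst !fctE (_ : (0 : V -> R) x = 0) //.
generalize (partial k (partial j g) x) (partial k (partial i f) x).
by generalize (partial i f x) (partial j g x) => *; ring.
Qed.

(** By the formula for the gradient of a bracket, each double bracket is
    the difference of two terms of the form [T u v w], which has the Hessian of
    [w] between the gradients of [u] and [v].  Such a term is symmetric in [u]
    and [v], because the Hessian is symmetric and the two
    factors [L x] both change sign under transposition; so the terms cancel in
    minors. *)
Lemma bracket_jacobi f g h : regular f -> regular g -> regular h ->
  {[{[f, g]}, h]} = {[{[f, h]}, g]} + {[f, {[g, h]}]}.
Proof.
move=> fr gr hr; rewrite [{[f, {[g, h]}]}]bracketC; apply/funext => x.
pose T u v w := (grad u x *m L x *m hessian w x *m L x *m (grad v x)^T) 0 0.
have TC u v w : regular w -> T u v w = T v u w.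
  move=> wr; have tr11 (M : 'M[R]_1) : M 0 0 = M^T 0 0 by rewrite mxE.
  rewrite /T [LHS]tr11 !trmx_mul trmxK hessian_sym // !L_antisym.
  by rewrite !(mulmxN, mulNmx) opprK !mulmxA.
have BT u v w : regular u -> regular v ->
    {[{[u, v]}, w]} x = T u w v - T v w u.
  by move=> ur vr; rewrite {1}/bracket grad_bracket // !mulmxBl mxE [in X in _ + X]mxE.
clearbody T; rewrite !fctE !BT // (TC f h g gr) (TC g h f fr) (TC f g h hr).
ring.
Qed.

End ConstantPoisson.

(** * Generic independence *)

Lemma free_row_free (K : fieldType) (N n : nat) (X : n.-tuple 'rV[K]_N)
    (M : 'M[K]_(n, N)) :
  (forall i, row i M = tnth X i) -> free X = row_free M.
Proof.
move=> MX.
have comb (k : 'I_n -> K) :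
    \sum_(i < n) k i *: X`_i = (\row_i k i) *m M.
  rewrite mulmx_sum_row; apply: eq_bigr => i _.
  by rewrite MX mxE (tnth_nth 0).
apply/freeP/idP => [Xfree|Mfree k].
  rewrite -kermx_eq0; apply/rowV0P => u /sub_kermxP uM.
  apply/rowP => i; rewrite mxE; apply: (Xfree (fun i => u 0 i)).
  by rewrite comb -[RHS]uM; congr (_ *m _); apply/rowP => j; rewrite mxE.
rewrite comb => kM i.
have /rowP/(_ i) : \row_i k i = 0 :> 'rV_n.
  by apply: (row_free_inj Mfree); rewrite kM mul0mx.
by rewrite !mxE.
Qed.

Section Genericity.
Variables (R : realType) (N : nat).
Notation V := 'rV[R]_N.
Implicit Types (f g : V -> R) (s t : seq (V -> R)) (x : V).

Definition jacobian s x : 'M[R]_(size s, N) :=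
  \matrix_(i, j) partial j (tnth (in_tuple s) i) x.

Lemma row_jacobian s x i :
  row i (jacobian s x) = grad (tnth (in_tuple s) i) x.
Proof. by apply/rowP => j; rewrite !mxE. Qed.

Lemma free_jacobian s x :
  free [seq grad f x | f <- s] = row_free (jacobian s x).
Proof.
apply: (free_row_free (X := map_tuple (fun f => grad f x) (in_tuple s))) => i.
by rewrite row_jacobian tnth_map.
Qed.

Lemma generically_imply (P Q : V -> Prop) :
  (forall x, P x -> Q x) -> generically P -> generically Q.
Proof. by move=> PQ [U [Uo Ud UP]]; exists U; split=> // x /UP/PQ. Qed.

Lemma generically_and (P Q : V -> Prop) :
  generically P -> generically Q -> generically (fun x => P x /\ Q x).
Proof.
move=> [U [Uo Ud UP]] [W [Wo Wd WQ]]; exists (U `&` W); split.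
- exact: openI.
- exact: denseI.
- by move=> x [/UP ? /WQ].
Qed.

(** A right inverse [B] of the Jacobian at the given point turns independence
    into the nonvanishing of the single regular function
    [x |-> \det (jacobian s x *m B)]. *)
Lemma regular_generically_independent s x0 :
  (forall f, f \in s -> regular f) ->
  free [seq grad f x0 | f <- s] -> generically_independent s.
Proof.
move=> sr; rewrite free_jacobian => /row_freeP[B JB].
pose g : V -> R := fun x => \det (jacobian s x *m B).
have gr : regular g.
  rewrite (_ : g = \sum_(p : {perm 'I_(size s)}) (cst ((-1) ^+ p) *
      \prod_i \sum_j (partial j (tnth (in_tuple s) i) * cst (B j (p i))))).
    apply: regular_sum => p _; apply: regularM => //; apply: regular_prod => i _.
    apply: regular_sum => j _; apply: regularM => //; apply: regular_partial.
    by apply: sr; exact: mem_tnth.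
  apply/funext => x; rewrite fct_sumE; apply: eq_bigr => p _.
  rewrite fctE; congr (_ * _); rewrite fct_prodE; apply: eq_bigr => i _.
  by rewrite mxE fct_sumE; apply: eq_bigr => j _; rewrite !mxE.
have g0 : g x0 != 0 by rewrite /g JB det1 oner_neq0.
have [Uo Ud] := regular_nonzero_dense gr g0.
exists [set x | g x != 0]; split=> // x /= gx.
rewrite free_jacobian; apply/row_freeP.
exists (B *m invmx (jacobian s x *m B)).
by rewrite mulmxA mulmxV // unitmxE unitfE.
Qed.

End Genericity.

(** * Completeness from the center *)

Section BilinearComplement.
Variables (K : fieldType) (N : nat) (L : 'M[K]_N) (s t : seq 'rV[K]_N).
Hypothesis L_unit : L \in unitmx.

(** The right-hand side is contained in the left-hand side, which has dimension
    [N - size t]. *)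
Lemma perp_span : free s -> free t -> (size s + size t)%N = N ->
  (forall u v, u \in s -> v \in t -> (u *m L *m v^T) 0 0 = 0) ->
  forall u, (forall v, v \in t -> (u *m L *m v^T) 0 0 = 0) <-> u \in << s >>%VS.
Proof.
move=> sf tf st sLt.
pose T : 'M[K]_(size t, N) := \matrix_i tnth (in_tuple t) i.
have /row_freeP[B TB] : row_free T.
  by rewrite -(free_row_free (X := in_tuple t)) // => i; rewrite rowK.
pose phi : 'Hom('rV[K]_N, 'rV[K]_(size t)) := linfun (mulmxr (L *m T^T)).
have kerP u : (u \in lker phi) <-> forall v, v \in t -> (u *m L *m v^T) 0 0 = 0.
  have phiE i : phi u 0 i = (u *m L *m (tnth (in_tuple t) i)^T) 0 0.
    rewrite lfunE /= mulmxA !mxE; apply: eq_bigr => j _.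
    by rewrite [in RHS]mxE; congr (_ * _); rewrite !mxE.
  rewrite memv_ker; split=> [/eqP phi0 v vt|uv].
    have [i ->] : exists i, v = tnth (in_tuple t) i by apply/tnthP.
    by rewrite -phiE phi0 mxE.
  by apply/eqP/rowP => i; rewrite phiE uv ?mxE // mem_tnth.
have limgT : limg phi = fullv.
  apply/vspaceP => w; rewrite memvf; apply/memv_imgP.
  exists (w *m B^T *m invmx L); first exact: memvf.
  by rewrite lfunE /= mulmxA mulmxKV // -mulmxA -trmx_mul TB trmx1 mulmx1.
have sker : (<< s >> <= lker phi)%VS.
  by apply/span_subvP => u us; apply/kerP => v; exact: sLt.
have dimker : \dim (lker phi) = size s.
  have := limg_ker_dim phi fullv; rewrite capfv limgT !dimvf /dim /= !mul1n.
  by move=> e; apply: (@addIn (size t)); rewrite e st.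
have -> : << s >>%VS = lker phi.
  by apply/eqP; rewrite eqEdim sker dimker (eqP sf) leqnn.
by move=> u; rewrite kerP.
Qed.

Lemma span_mulmx0 (X : seq 'rV[K]_N) (w : 'cV[K]_N) u : u \in <<X>>%VS ->
  (forall v, v \in X -> (v *m w) 0 0 = 0) -> (u *m w) 0 0 = 0.
Proof.
move=> /(coord_span (X := in_tuple X)) -> Xw; rewrite mulmx_suml summxE big1 // => i _.
by rewrite -scalemxAl mxE Xw ?mulr0 // mem_nth.
Qed.

End BilinearComplement.

Section Completeness.
Variables (R : realType) (N : nat) (L : 'rV[R]_N -> 'M[R]_N).
Hypothesis L_const : forall x, L x = L 0.
Hypothesis L_antisym : forall x, (L x)^T = - L x.
Hypothesis L_unit : forall x, L x \in unitmx.
Notation V := 'rV[R]_N.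
Implicit Types (f g c : V -> R) (s cs : seq (V -> R)) (x : V)
  (G F : set (V -> R)).

Definition centralizer G : set (V -> R) :=
  [set f | regular f /\ forall c, G c -> bracket L f c = 0].

Lemma lie_closed_centralizer G :
  (forall c, G c -> regular c) -> lie_closed L (centralizer G).
Proof.
move=> Gr; split.
- by split=> [|c _]; [exact: regular0|exact: bracket_cstl].
- move=> a f g [fr fG] [gr gG].
  have ar : regular (cst a * f) by exact: regularM.
  split=> [|c Gc]; first exact: (regularD ar gr).
  rewrite -[fun x => _]/(cst a * f + g) bracketDl // bracketMl //.
  by rewrite (bracket_cstl L_const) fG // gG // !mulr0 !addr0.
- move=> f g [fr fG] [gr gG]; split=> [|c Gc]; first exact: regular_bracket.
  rewrite bracket_jacobi //; last exact: Gr.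
  rewrite fG // gG //; rewrite -[0 : V -> R]/(cst 0) (bracket_cstl L_const).
  by rewrite (bracket_cstr L_const) // addr0.
Qed.

Lemma lie_closed_generated G : lie_closed L (lie_generated L G).
Proof.
split=> [A [[A0 _ _] _]//|a f g Ff Fg A [cA GA]|f g Ff Fg A [cA GA]];
  case: (cA) => _ AD AB; [apply: AD|apply: AB]; by [apply: Ff|apply: Fg].
Qed.

Lemma lie_generated_centralizer G H :
  (forall c, H c -> regular c) -> G `<=` centralizer H ->
  lie_generated L G `<=` centralizer H.
Proof. by move=> Hr; apply: smallest_sub; exact: lie_closed_centralizer. Qed.

Lemma lie_generated_commutative G : (forall f, G f -> regular f) ->
  (forall f g, G f -> G g -> bracket L f g = 0) ->
  commutative_algebra L (lie_generated L G).
Proof.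
move=> Gr GG.
have FG : lie_generated L G `<=` centralizer G.
  by apply: lie_generated_centralizer => // f Gf; split=> [|g]; [exact: Gr|exact: GG].
have Fr f : lie_generated L G f -> regular f by case/FG.
have FF : lie_generated L G `<=` centralizer (lie_generated L G).
  apply: lie_generated_centralizer => // f Gf; split=> [|g /FG[_ gG]].
    exact: Gr.
  by apply: bracket0C => //; exact: gG.
by move=> f g /FF[_ fF] Fg x; rewrite fF.
Qed.

Lemma grad_lin (a : R) f g x : regular f -> regular g ->
  grad (fun y => a * f y + g y) x = a *: grad f x + grad g x.
Proof.
move=> fr gr; apply/rowP => i; rewrite !mxE.
have ar : regular (cst a * f) by exact: regularM.
rewrite -[fun y => _]/(cst a * f + g) partialD // partialM //.
by rewrite partial_cst !fctE (_ : (0 : V -> R) x = 0) // mulr0 addr0.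
Qed.

(** The independence criterion behind all the generic ranks: a functional
    [{g, -}] at [x] that sees [f] but none of the functions in [s]. *)
Lemma free_cons_bracket (g f : V -> R) s x :
  bracket L g f x != 0 -> (forall h, h \in s -> bracket L g h x = 0) ->
  free [seq grad h x | h <- s] -> free [seq grad h x | h <- f :: s].
Proof.
move=> gf gs sf; rewrite /= free_cons sf andbT; apply: contra_neqN gf => fs.
pose w := (grad g x *m L x)^T.
have wE h : bracket L g h x = (grad h x *m w) 0 0.
  have tr11 (M : 'M[R]_1) : M 0 0 = M^T 0 0 by rewrite mxE.
  by rewrite /bracket tr11 trmx_mul trmxK.
rewrite wE; apply: (span_mulmx0 fs) => _ /mapP[h hs ->].
by rewrite -wE gs.
Qed.

Lemma free_cat_bracket (T : eqType) (ks : seq T) (F G : T -> V -> R) s x :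
  uniq ks -> (forall k, k \in ks -> bracket L (G k) (F k) x != 0) ->
  (forall k j, k \in ks -> j \in ks -> j != k -> bracket L (G k) (F j) x = 0) ->
  (forall k h, k \in ks -> h \in s -> bracket L (G k) h x = 0) ->
  free [seq grad h x | h <- s] ->
  free [seq grad h x | h <- [seq F k | k <- ks] ++ s].
Proof.
move=> + + + + sf; elim: ks => [//|k ks IH] /= /andP[kks uks] GF GF0 Gs.
apply: (free_cons_bracket (g := G k)).
- by apply: GF; rewrite inE eqxx.
- move=> h; rewrite mem_cat => /orP[/mapP[j jks ->]|hs].
    apply: GF0; rewrite ?inE ?eqxx ?jks ?orbT //.
    by apply: contraNneq kks => <-.
  by apply: Gs => //; rewrite inE eqxx.
- apply: IH => // [j jks|j i jks iks|j h jks].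
  + by apply: GF; rewrite inE jks orbT.
  + by apply: GF0; rewrite inE ?jks ?iks orbT.
  + by apply: Gs; rewrite inE jks orbT.
Qed.

(** If the functions in [cs] commute with the generators [s] and with each
    other, then they commute with the whole algebra: by the Jacobi identity the
    functions that commute with [cs] form a Lie algebra.  So all
    differentials of the algebra lie in the orthogonal complement of
    the differentials of [cs] for [L], which by the dimension count is spanned
    by the differentials of [s].  The kernel is the
    orthogonal complement of this span, that is the span of the differentials
    of [cs]. *)
Theorem complete_of_center s cs H x0 :
  (forall f, f \in s -> regular f) -> (forall c, c \in cs -> regular c) ->
  (forall f c, f \in s -> c \in cs -> bracket L f c = 0) ->
  (forall c d, c \in cs -> d \in cs -> bracket L c d = 0) ->
  H \in cs -> (size s + size cs)%N = N ->
  free [seq grad f x0 | f <- s] -> free [seq grad c x0 | c <- cs] ->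
  let F := lie_generated L [set` s] in
  [/\ is_ddim F (size s), forall f, f \in s -> first_integral L H f,
      generically_independent s & complete_algebra L H F].
Proof.
move=> sr csr scs cscs Hcs sz sfree csfree F.
have sgen := regular_generically_independent sr sfree.
have csgen := regular_generically_independent csr csfree.
have sF f : f \in s -> F f by move=> fs; exact: sub_gen_smallest.
have FC : F `<=` centralizer [set` cs].
  apply: lie_generated_centralizer => // f fs; split=> [|c]; first exact: sr.
  exact: scs.
have Fr f : F f -> regular f by case/FC.
have FH f : F f -> first_integral L H f.
  move=> /FC[fr fcs]; split; first exact: regular_smooth.
  by move=> x; rewrite fcs.
pose good x := free [seq grad f x | f <- s] /\ free [seq grad c x | c <- cs].
have goodG : generically good by exact: generically_and.
have perp f c x : F f -> c \in cs -> (grad f x *m L x *m (grad c x)^T) 0 0 = 0.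
  by move=> /FC[_ fcs] ccs; rewrite -[LHS]/(bracket L f c x) fcs.
have codistE x u : good x ->
    codist F x u <-> u \in <<[seq grad f x | f <- s]>>%VS.
  move=> [sx csx]; split=> [[f Ff <-]|].
    apply/(perp_span (L_unit x) sx csx); rewrite ?size_map //.
      by move=> _ _ /mapP[g gs ->] /mapP[c cc ->]; apply: perp => //; exact: sF.
    by move=> _ /mapP[c cc ->]; exact: perp.
  move=> /(coord_span (X := map_tuple (fun f => grad f x) (in_tuple s))) ->.
  have [F0 FD _] : lie_closed L F by exact: lie_closed_generated.
  elim/big_ind: _ => [|_ _ [f Ff <-] [g Fg <-]|i _].
  - exists (fun=> 0) => //; apply/rowP => i; rewrite !mxE.
    by rewrite -[fun=> 0]/(cst 0) partial_cst.
  - exists (fun y => 1 * f y + g y); first exact: FD.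
    by rewrite grad_lin ?scale1r //; exact: Fr.
  - rewrite (nth_map 0) //=; set f := nth _ _ _; set a := coord _ _ _.
    have Ff : F f by apply: sF; exact: mem_nth.
    exists (fun y => a * f y + 0); first exact: (FD _ _ (fun=> 0)).
    rewrite (@grad_lin a f (cst 0)) //; last exact: Fr.
    rewrite [grad (cst 0) x](_ : _ = 0) ?addr0 //.
    by apply/rowP => j; rewrite !mxE partial_cst.
have kerE x u : good x ->
    codist_ker L F x u <-> u \in <<[seq grad c x | c <- cs]>>%VS.
  move=> gx; have [sx csx] := gx.
  have cs_perp c f : c \in cs -> F f ->
      (grad c x *m L x *m (grad f x)^T) 0 0 = 0.
    move=> cc Ff; rewrite -[LHS]/(bracket L c f x).
    have /FC[_ fcs] := Ff.
    by rewrite (bracket0C L_antisym (fcs _ cc)).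
  have csP := perp_span (L_unit x) csx sx.
  have csE v : (forall w, w \in [seq grad f x | f <- s] ->
      (v *m L x *m w^T) 0 0 = 0) <-> v \in <<[seq grad c x | c <- cs]>>%VS.
    apply: csP; rewrite ?size_map 1?addnC //.
    by move=> _ _ /mapP[c cc ->] /mapP[f fs ->]; apply: cs_perp => //; exact: sF.
  split=> [[_ uF]|uc].
    apply/csE => _ /mapP[f fs ->]; apply: uF.
    by exists f => //; exact: sF.
  split=> [|_ [f Ff <-]]; last first.
    rewrite -mulmxA; apply: (span_mulmx0 uc) => _ /mapP[c cc ->].
    by rewrite mulmxA; exact: cs_perp.
  apply/(codistE _ _ gx)/(perp_span (L_unit x) sx csx); rewrite ?size_map //.
    by move=> _ _ /mapP[g gs ->] /mapP[c cc ->]; apply: perp => //; exact: sF.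
  move=> _ /mapP[d dc ->]; rewrite -mulmxA.
  apply: (span_mulmx0 uc) => _ /mapP[c cc ->]; rewrite mulmxA.
  by rewrite -[LHS]/(bracket L c d x) cscs.
have ddimF : is_ddim F (size s).
  apply: generically_imply goodG => x gx; exists <<[seq grad f x | f <- s]>>%VS.
    by move=> u; exact: codistE.
  by have [/eqP -> _] := gx; rewrite size_map.
have dindF : is_dind L F (size cs).
  apply: generically_imply goodG => x gx; exists <<[seq grad c x | c <- cs]>>%VS.
    by move=> u; exact: kerE.
  by have [_ /eqP ->] := gx; rewrite size_map.
split=> //; first by move=> f /sF/FH.
split; last by exists (size s), (size cs).
by split=> //; exact: lie_closed_generated.
Qed.

End Completeness.

(** * The unitary symmetry in canonical coordinates *)

Record canonical_coordinates (R : realType) (N n : nat)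
    (L : 'rV[R]_N -> 'M[R]_N) (X Y A B : 'I_n -> 'rV[R]_N -> R) : Prop := {
  canonical_regX : forall k, regular (X k);
  canonical_regY : forall k, regular (Y k);
  canonical_regA : forall k, regular (A k);
  canonical_regB : forall k, regular (B k);
  canonical_XX : forall j k, bracket L (X j) (X k) = 0;
  canonical_XY : forall j k, bracket L (X j) (Y k) = 0;
  canonical_YY : forall j k, bracket L (Y j) (Y k) = 0;
  canonical_XA : forall j k, bracket L (X j) (A k) = (j == k)%:R;
  canonical_XB : forall j k, bracket L (X j) (B k) = 0;
  canonical_YA : forall j k, bracket L (Y j) (A k) = 0;
  canonical_YB : forall j k, bracket L (Y j) (B k) = (j == k)%:R;
  canonical_AA : forall j k, bracket L (A j) (A k) = 0;
  canonical_AB : forall j k, bracket L (A j) (B k) = 0;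
  canonical_BB : forall j k, bracket L (B j) (B k) = 0 }.

Section CanonicalCoordinates.
Variables (R : realType) (N n : nat) (L : 'rV[R]_N -> 'M[R]_N).
Hypothesis L_const : forall x, L x = L 0.
Hypothesis L_antisym : forall x, (L x)^T = - L x.
Notation V := 'rV[R]_N.
Notation "{[ f , g ]}" := (bracket L f g) (format "{[ f ,  g ]}").

Variables X Y A B : 'I_n -> V -> R.
Hypothesis canon : canonical_coordinates L X Y A B.
Let rX := canonical_regX canon.
Let rY := canonical_regY canon.
Let rA := canonical_regA canon.
Let rB := canonical_regB canon.
Let XX := canonical_XX canon.
Let XY := canonical_XY canon.
Let YY := canonical_YY canon.
Let XA := canonical_XA canon.
Let XB := canonical_XB canon.
Let YA := canonical_YA canon.
Let YB := canonical_YB canon.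
Let AA := canonical_AA canon.
Let AB := canonical_AB canon.
Let BB := canonical_BB canon.
#[local] Hint Resolve rX rY rA rB : core.
#[local] Opaque bracket.

Let YX j k : {[Y j, X k]} = 0. Proof. exact: bracket0C (XY k j). Qed.
Let BX j k : {[B j, X k]} = 0. Proof. exact: bracket0C (XB k j). Qed.
Let AY j k : {[A j, Y k]} = 0. Proof. exact: bracket0C (YA k j). Qed.
Let BA j k : {[B j, A k]} = 0. Proof. exact: bracket0C (AB k j). Qed.
Let AX j k : {[A j, X k]} = - (j == k)%:R.
Proof. by rewrite (bracketC L_antisym) XA eq_sym. Qed.
Let BY j k : {[B j, Y k]} = - (j == k)%:R.
Proof. by rewrite (bracketC L_antisym) YB eq_sym. Qed.

Let coordE := (XX, XY, XA, XB, YX, YY, YA, YB, AX, AY, AA, AB, BX, BY, BA, BB).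
Let leibnizl := (bracketDl L_const, bracketNl L_const, bracketMl L_const).
Let leibnizr := (bracketDr L_const L_antisym, bracketNr L_const L_antisym,
                 bracketMr L_const L_antisym).

Definition sqnorm_q : V -> R := \sum_k (X k * X k + Y k * Y k).
Definition sqnorm_p : V -> R := \sum_k (A k * A k + B k * B k).
Definition omega_qp : V -> R := \sum_k (Y k * A k - X k * B k).
Definition dot_qp : V -> R := \sum_k (X k * A k + Y k * B k).

(** The moment of the rotation of the [k]-th complex coordinate, and a
    diagonal entry of the moment map of the unitary group. *)
Definition angmom k : V -> R := X k * B k - Y k * A k.

Lemma regular_angmom k : regular (angmom k). Proof. by rewrite /angmom; auto. Qed.
Lemma regular_sqnorm_q : regular sqnorm_q.
Proof. by apply: regular_sum => k _; auto. Qed.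
Lemma regular_sqnorm_p : regular sqnorm_p.
Proof. by apply: regular_sum => k _; auto. Qed.
Lemma regular_omega_qp : regular omega_qp.
Proof. by apply: regular_sum => k _; auto. Qed.
Lemma regular_dot_qp : regular dot_qp.
Proof. by apply: regular_sum => k _; auto. Qed.
#[local] Hint Resolve regular_angmom regular_sqnorm_q regular_sqnorm_p
  regular_omega_qp regular_dot_qp : core.

Lemma sum_delta (F : 'I_n -> V -> R) k : \sum_j (j == k)%:R * F j = F k.
Proof.
rewrite (bigD1 k) //= eqxx mul1r big1 ?addr0 // => j /negPf ->.
by rewrite mul0r.
Qed.

Lemma delta_subst (F : 'I_n -> V -> R) j k :
  (j == k)%:R * F j = (j == k)%:R * F k.
Proof. by case: eqP => [->//|_]; rewrite !mul0r. Qed.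

(** The bracket of a quadratic invariant with a coordinate is a sum over all
    planes with Kronecker deltas; [G] is the value that the sum selects. *)
Ltac quadratic_bracket k G :=
  rewrite (bracket_suml L_const) => [|?]; [|by auto];
  rewrite -[RHS](sum_delta G k); apply: eq_bigr => j _;
  rewrite !leibnizl ?coordE; auto; cbv beta; ring.

Lemma sqnorm_q_X k : {[sqnorm_q, X k]} = 0.
Proof. by quadratic_bracket k (fun _ : 'I_n => 0 : V -> R). Qed.
Lemma sqnorm_q_Y k : {[sqnorm_q, Y k]} = 0.
Proof. by quadratic_bracket k (fun _ : 'I_n => 0 : V -> R). Qed.
Lemma sqnorm_q_A k : {[sqnorm_q, A k]} = 2 * X k.
Proof. by quadratic_bracket k (fun j => 2 * X j). Qed.
Lemma sqnorm_q_B k : {[sqnorm_q, B k]} = 2 * Y k.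
Proof. by quadratic_bracket k (fun j => 2 * Y j). Qed.
Lemma sqnorm_p_X k : {[sqnorm_p, X k]} = - (2 * A k).
Proof. by quadratic_bracket k (fun j => - (2 * A j)). Qed.
Lemma sqnorm_p_Y k : {[sqnorm_p, Y k]} = - (2 * B k).
Proof. by quadratic_bracket k (fun j => - (2 * B j)). Qed.
Lemma sqnorm_p_A k : {[sqnorm_p, A k]} = 0.
Proof. by quadratic_bracket k (fun _ : 'I_n => 0 : V -> R). Qed.
Lemma sqnorm_p_B k : {[sqnorm_p, B k]} = 0.
Proof. by quadratic_bracket k (fun _ : 'I_n => 0 : V -> R). Qed.
Lemma omega_qp_X k : {[omega_qp, X k]} = - Y k.
Proof. by quadratic_bracket k (fun j => - Y j). Qed.
Lemma omega_qp_Y k : {[omega_qp, Y k]} = X k.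
Proof. by quadratic_bracket k X. Qed.
Lemma omega_qp_A k : {[omega_qp, A k]} = - B k.
Proof. by quadratic_bracket k (fun j => - B j). Qed.
Lemma omega_qp_B k : {[omega_qp, B k]} = A k.
Proof. by quadratic_bracket k A. Qed.
Lemma dot_qp_X k : {[dot_qp, X k]} = - X k.
Proof. by quadratic_bracket k (fun j => - X j). Qed.
Lemma dot_qp_Y k : {[dot_qp, Y k]} = - Y k.
Proof. by quadratic_bracket k (fun j => - Y j). Qed.
Lemma dot_qp_A k : {[dot_qp, A k]} = A k.
Proof. by quadratic_bracket k A. Qed.
Lemma dot_qp_B k : {[dot_qp, B k]} = B k.
Proof. by quadratic_bracket k B. Qed.

Let invariantE := (sqnorm_q_X, sqnorm_q_Y, sqnorm_q_A, sqnorm_q_B,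
  sqnorm_p_X, sqnorm_p_Y, sqnorm_p_A, sqnorm_p_B,
  omega_qp_X, omega_qp_Y, omega_qp_A, omega_qp_B,
  dot_qp_X, dot_qp_Y, dot_qp_A, dot_qp_B).

Lemma angmom_X j k : {[angmom j, X k]} = (j == k)%:R * Y k.
Proof.
rewrite -(delta_subst Y) /angmom !leibnizl ?coordE; auto; ring.
Qed.
Lemma angmom_Y j k : {[angmom j, Y k]} = - ((j == k)%:R * X k).
Proof.
rewrite -(delta_subst X) /angmom !leibnizl ?coordE; auto; ring.
Qed.
Lemma angmom_A j k : {[angmom j, A k]} = (j == k)%:R * B k.
Proof.
rewrite -(delta_subst B) /angmom !leibnizl ?coordE; auto; ring.
Qed.
Lemma angmom_B j k : {[angmom j, B k]} = - ((j == k)%:R * A k).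
Proof.
rewrite -(delta_subst A) /angmom !leibnizl ?coordE; auto; ring.
Qed.
Let angmomE := (angmom_X, angmom_Y, angmom_A, angmom_B).

(** Invariance under U(n), expressed through the dual pair: the first integrals
    are found in the commutant of these four quadratic functions. *)
Definition quad_invariant f : Prop :=
  [/\ {[sqnorm_q, f]} = 0, {[sqnorm_p, f]} = 0,
      {[omega_qp, f]} = 0 & {[dot_qp, f]} = 0].

Lemma quad_invariant_angmom k : quad_invariant (angmom k).
Proof. by split; rewrite /angmom !leibnizr ?invariantE; auto; ring. Qed.

Lemma angmom_angmom j k : {[angmom j, angmom k]} = 0.
Proof. by rewrite [angmom k]/angmom !leibnizr ?angmomE; auto; ring. Qed.

Lemma omega_qpE : omega_qp = - \sum_k angmom k.
Proof. by rewrite -sumrN; apply: eq_bigr => k _; rewrite /angmom; ring. Qed.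

(** The form [omega_qp] generates the scalar phase rotations, which belong to
    the diagonal torus. *)
Lemma omega_qp_comm f : (forall k, {[angmom k, f]} = 0) -> {[omega_qp, f]} = 0.
Proof.
move=> rf; rewrite omega_qpE (bracketNl L_const) ?(bracket_suml L_const) //.
  by rewrite big1 ?oppr0.
by apply: regular_sum => k _.
Qed.

Lemma sqnorm_q_p : {[sqnorm_q, sqnorm_p]} = 4 * dot_qp.
Proof.
rewrite (bracket_sumr L_const L_antisym) => [|k]; last by auto.
rewrite mulr_sumr; apply: eq_bigr => k _.
by rewrite !leibnizr ?invariantE; auto; ring.
Qed.

Lemma sqnorm_q_dot : {[sqnorm_q, dot_qp]} = 2 * sqnorm_q.
Proof.
rewrite (bracket_sumr L_const L_antisym) => [|k]; last by auto.
rewrite mulr_sumr; apply: eq_bigr => k _.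
by rewrite !leibnizr ?invariantE; auto; ring.
Qed.

Lemma sqnorm_p_dot : {[sqnorm_p, dot_qp]} = - (2 * sqnorm_p).
Proof.
rewrite (bracket_sumr L_const L_antisym) => [|k]; last by auto.
rewrite mulr_sumr -sumrN; apply: eq_bigr => k _.
by rewrite !leibnizr ?invariantE; auto; ring.
Qed.

Lemma omega_qp_invariant :
  [/\ {[omega_qp, sqnorm_q]} = 0, {[omega_qp, sqnorm_p]} = 0 &
      {[omega_qp, dot_qp]} = 0].
Proof.
by split; apply: omega_qp_comm => k; apply: bracket0C => //;
  case: (quad_invariant_angmom k).
Qed.

(** The sum of the principal 2x2 minors of the moment map, that is of the
    |z_j w_k - z_k w_j|^2 over j < k, rewritten by Lagrange's identity. *)
Definition casimir : V -> R :=
  sqnorm_q * sqnorm_p - dot_qp * dot_qp - omega_qp * omega_qp.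

Lemma regular_casimir : regular casimir.
Proof. by rewrite /casimir; auto 6. Qed.

Lemma casimir_invariant : [/\ {[sqnorm_q, casimir]} = 0,
  {[sqnorm_p, casimir]} = 0 & {[omega_qp, casimir]} = 0].
Proof.
have [w1 w2 w3] := omega_qp_invariant.
have z1 := bracket0C L_antisym w1; have z2 := bracket0C L_antisym w2.
rewrite /casimir; split; rewrite !leibnizr; auto.
- rewrite bracketff // sqnorm_q_p sqnorm_q_dot z1; ring.
- rewrite bracketff // [{[sqnorm_p, sqnorm_q]}](bracketC L_antisym).
  rewrite sqnorm_q_p sqnorm_p_dot z2; ring.
- by rewrite w1 w2 w3 bracketff //; ring.
Qed.

Lemma casimir_comm f : quad_invariant f -> {[casimir, f]} = 0.
Proof.
move=> [f1 f2 f3 f4]; rewrite /casimir !leibnizl; auto.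
rewrite f1 f2 f3 f4; ring.
Qed.

(* [S] stands for 1 / (1 + |q|^2); it enters only through its derivative. *)
Variables (C : R) (S : V -> R).
Hypothesis rS : regular S.
Hypothesis S_bracket : forall f, {[S, f]} = - (S * S * {[sqnorm_q, f]}).
#[local] Hint Resolve rS regular_casimir : core.

Definition hamiltonian : V -> R :=
  cst 2^-1 * (sqnorm_p + cst C * omega_qp + cst (C ^+ 2 / 4) * sqnorm_q
    - (omega_qp + cst (C / 2) * sqnorm_q) * (omega_qp + cst (C / 2) * sqnorm_q)
      * S).

Lemma regular_hamiltonian : regular hamiltonian.
Proof. by rewrite /hamiltonian; auto 10. Qed.
#[local] Hint Resolve regular_hamiltonian : core.

(** Once [f] commutes with |q|^2 and omega, the potential terms and [S] do not
    contribute. *)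
Lemma hamiltonian_bracket f : {[sqnorm_q, f]} = 0 -> {[omega_qp, f]} = 0 ->
  {[hamiltonian, f]} = cst 2^-1 * {[sqnorm_p, f]}.
Proof.
move=> f1 f3; rewrite /hamiltonian.
set a := cst 2^-1; set b := cst C; set c := cst (C ^+ 2 / 4).
set d := cst (C / 2).
have [ar br] : regular a /\ regular b by split; exact: regular_cst.
have [cr dr] : regular c /\ regular d by split; exact: regular_cst.
have [a0 b0] : {[a, f]} = 0 /\ {[b, f]} = 0.
  by split; exact: (bracket_cstl L_const).
have [c0 d0] : {[c, f]} = 0 /\ {[d, f]} = 0.
  by split; exact: (bracket_cstl L_const).
clearbody a b c d.
have Wr : regular (omega_qp + d * sqnorm_q) by auto.
have W0 : {[omega_qp + d * sqnorm_q, f]} = 0.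
  by rewrite !leibnizl ?f1 ?f3 ?d0; auto; ring.
move: W0 Wr; generalize (omega_qp + d * sqnorm_q) => W W0 Wr.
rewrite !leibnizl; auto 6.
rewrite S_bracket f1 f3 a0 b0 c0 W0; ring.
Qed.

Lemma hamiltonian_comm f : [/\ {[sqnorm_q, f]} = 0,
  {[sqnorm_p, f]} = 0 & {[omega_qp, f]} = 0] -> {[hamiltonian, f]} = 0.
Proof. by move=> [f1 f2 f3]; rewrite hamiltonian_bracket // f2 mulr0. Qed.

(** Among the integrals only the Hamiltonian fails to commute with |q|^2, and
    this separates its differential from all the others wherever the dot
    product of [q] and [p] does not vanish. *)
Lemma sqnorm_q_hamiltonian : {[sqnorm_q, hamiltonian]} = 2 * dot_qp.
Proof.
have [w1 _ _] := omega_qp_invariant.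
rewrite (bracketC L_antisym) hamiltonian_bracket ?bracketff //.
rewrite (bracketC L_antisym) sqnorm_q_p.
have half : cst 2^-1 * 2 = 1 :> (V -> R).
  by apply/funext => x; apply: mulVf; rewrite pnatr_eq0.
rewrite -[RHS]mul1r -half; ring.
Qed.

(** The real and imaginary parts of z_o w_k - z_k w_o, where z = X + i Y and
    w = A + i B. *)
Variable o : 'I_n.
Definition minor_re k : V -> R := X o * A k - Y o * B k - X k * A o + Y k * B o.
Definition minor_im k : V -> R := X o * B k + Y o * A k - X k * B o - Y k * A o.
Definition sqminor k : V -> R :=
  minor_re k * minor_re k + minor_im k * minor_im k.

Lemma regular_minor_re k : regular (minor_re k).
Proof. by rewrite /minor_re; auto 6. Qed.
Lemma regular_minor_im k : regular (minor_im k).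
Proof. by rewrite /minor_im; auto 6. Qed.
#[local] Hint Resolve regular_minor_re regular_minor_im : core.
Lemma regular_sqminor k : regular (sqminor k).
Proof. by rewrite /sqminor; auto. Qed.
#[local] Hint Resolve regular_sqminor : core.

(** The invariance of |z_o w_k - z_k w_o|^2 under the three functions |q|^2,
    |p|^2 and q . p is that of a 2x2 determinant under SL(2) acting on the
    pair (z, w); omega rotates the phase of the determinant. *)
Lemma quad_invariant_sqminor k : quad_invariant (sqminor k).
Proof.
by split; rewrite /sqminor !leibnizr; auto; rewrite /minor_re /minor_im
  ?leibnizr ?invariantE; auto 6; ring.
Qed.

Lemma angmom_sqminor j k : {[angmom j, sqminor k]} = 0.
Proof.
by rewrite /sqminor !leibnizr; auto; rewrite /minor_re /minor_im
  ?leibnizr ?angmomE; auto 6; ring.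
Qed.

Lemma casimir_hamiltonian : {[casimir, hamiltonian]} = 0.
Proof. exact/(bracket0C L_antisym)/hamiltonian_comm/casimir_invariant. Qed.

Lemma quad_invariant_hamiltonian f : quad_invariant f -> {[hamiltonian, f]} = 0.
Proof. by case=> *; exact: hamiltonian_comm. Qed.

Lemma sqminor_X j k : k != o -> k != j -> {[sqminor j, X k]} = 0.
Proof.
move=> /negPf ko /negPf kj; rewrite /sqminor !leibnizl; auto.
rewrite /minor_re /minor_im ?leibnizl ?coordE ?(eq_sym _ k) ?ko ?kj /=; auto 6.
ring.
Qed.

Lemma sqminor_A j k : k != o -> k != j -> {[sqminor j, A k]} = 0.
Proof.
move=> /negPf ko /negPf kj; rewrite /sqminor !leibnizl; auto.
rewrite /minor_re /minor_im ?leibnizl ?coordE ?(eq_sym _ k) ?ko ?kj /=; auto 6.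
ring.
Qed.

Lemma sqminor_Xk k : k != o -> {[sqminor k, X k]} =
  - ((minor_re k * X o + minor_im k * Y o) *+ 2).
Proof.
move=> /negPf ko; rewrite /sqminor !leibnizl; auto.
rewrite /minor_re /minor_im ?leibnizl ?coordE ?(eq_sym _ k) ?ko ?eqxx /=; auto 6.
ring.
Qed.

Lemma sqminor_Ak k : k != o -> {[sqminor k, A k]} =
  - ((minor_re k * A o + minor_im k * B o) *+ 2).
Proof.
move=> /negPf ko; rewrite /sqminor !leibnizl; auto.
rewrite /minor_re /minor_im ?leibnizl ?coordE ?(eq_sym _ k) ?ko ?eqxx /=; auto 6.
ring.
Qed.

(** ** Commutation relations *)

Definition commutes_with_center f : Prop :=
  [/\ {[f, hamiltonian]} = 0, forall k, {[f, angmom k]} = 0 & {[f, casimir]} = 0].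

Lemma hamiltonian_commutes : commutes_with_center hamiltonian.
Proof.
split=> [|k|]; first exact: bracketff.
  by apply: quad_invariant_hamiltonian; exact: quad_invariant_angmom.
by apply: (bracket0C L_antisym); exact: casimir_hamiltonian.
Qed.

Lemma angmom_commutes k : commutes_with_center (angmom k).
Proof.
split=> [|j|]; last 1 first.
- by apply: (bracket0C L_antisym); apply: casimir_comm; exact: quad_invariant_angmom.
- apply: (bracket0C L_antisym); apply: quad_invariant_hamiltonian.
  exact: quad_invariant_angmom.
- exact: angmom_angmom.
Qed.

Lemma casimir_commutes : commutes_with_center casimir.
Proof.
split=> [|k|]; [exact: casimir_hamiltonian| |exact: bracketff].
by apply: casimir_comm; exact: quad_invariant_angmom.
Qed.

Lemma sqminor_commutes k : commutes_with_center (sqminor k).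
Proof.
split=> [|j|]; apply: (bracket0C L_antisym); last 1 first.
- by apply: casimir_comm; exact: quad_invariant_sqminor.
- by apply: quad_invariant_hamiltonian; exact: quad_invariant_sqminor.
- exact: angmom_sqminor.
Qed.

Definition sqminor_bracket j k : V -> R := {[sqminor j, sqminor k]}.

Lemma regular_sqminor_bracket j k : regular (sqminor_bracket j k).
Proof. exact: regular_bracket. Qed.
#[local] Hint Resolve regular_sqminor_bracket : core.

Lemma sqminor_bracket_commutes j k : commutes_with_center (sqminor_bracket j k).
Proof.
have [jH jI jK] := sqminor_commutes j; have [kH kI kK] := sqminor_commutes k.
have comm c : regular c -> {[sqminor j, c]} = 0 -> {[sqminor k, c]} = 0 ->
    {[sqminor_bracket j k, c]} = 0.
  move=> cr jc kc; rewrite /sqminor_bracket bracket_jacobi // jc kc.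
  rewrite -[0 : V -> R]/(cst 0) (bracket_cstl L_const).
  by rewrite (bracket_cstr L_const) // addr0.
by split=> [|i|]; apply: comm => //; exact: regular_angmom.
Qed.

(** ** Independence at a point *)

Variable x0 : V.
Hypothesis X_x0 : forall k, X k x0 = (k == o)%:R.
Hypothesis Y_x0 : forall k, Y k x0 = 0.
Hypothesis A_x0 : forall k, A k x0 = 1.
Hypothesis B_x0 : forall k, B k x0 = 0.

Let natfE (m : nat) : (m%:R : V -> R) x0 = m%:R.
Proof. by rewrite natmulfctE. Qed.
Let valE := (X_x0, Y_x0, A_x0, B_x0).

Lemma minor_re_x0 k : k != o -> minor_re k x0 = 1.
Proof.
by move=> /negPf ko; rewrite /minor_re !fctE !valE ko eqxx /=; ring.
Qed.

Lemma minor_im_x0 k : minor_im k x0 = 0.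
Proof. by rewrite /minor_im !fctE !valE; ring. Qed.

Lemma sqnorm_q_hamiltonian_x0 : {[sqnorm_q, hamiltonian]} x0 != 0.
Proof.
have d1 : dot_qp x0 = 1.
  rewrite /dot_qp fct_sumE (bigD1 o) //= big1 => [|j /negPf jo];
    by rewrite !fctE !valE ?eqxx ?jo /=; ring.
by rewrite sqnorm_q_hamiltonian !fctE d1 (natfE 2) mulr1 pnatr_eq0.
Qed.

Lemma sqminor_bracket_x0 j f : j != o ->
  {[sqminor j, f]} x0 = 2 * {[minor_re j, f]} x0.
Proof.
move=> jo; rewrite /sqminor !leibnizl; auto.
have at_x0 (g h a b : V -> R) : g x0 = 1 -> h x0 = 0 ->
    (g * a + g * a + (h * b + h * b)) x0 = 2 * a x0.
  by rewrite !fctE => -> ->; ring.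
exact: at_x0 (minor_re_x0 jo) (minor_im_x0 j).
Qed.

Lemma X_sqminor k j : k != o -> k != j -> {[X k, sqminor j]} = 0.
Proof. by move=> ko kj; apply/(bracket0C L_antisym)/sqminor_X. Qed.

Lemma A_sqminor k j : k != o -> k != j -> {[A k, sqminor j]} = 0.
Proof. by move=> ko kj; apply/(bracket0C L_antisym)/sqminor_A. Qed.

Lemma X_sqminor_x0 k : k != o -> {[X k, sqminor k]} x0 != 0.
Proof.
move=> ko; rewrite (bracketC L_antisym) sqminor_Xk // opprK natmulfctE !fctE !valE.
rewrite minor_re_x0 // minor_im_x0 eqxx mulr0 addr0 mulr1.
by rewrite -mulr_natr mul1r pnatr_eq0.
Qed.

Lemma X_angmom_x0 k j : {[X k, angmom j]} x0 = 0.
Proof. by rewrite (bracketC L_antisym) angmom_X !fctE !valE mulr0 oppr0. Qed.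

Lemma A_angmom_x0 k j : {[A k, angmom j]} x0 = 0.
Proof. by rewrite (bracketC L_antisym) angmom_A !fctE !valE mulr0 oppr0. Qed.

Lemma B_angmom_x0 k j : {[B k, angmom j]} x0 = (j == k)%:R.
Proof.
by rewrite (bracketC L_antisym) angmom_B !fctE !valE opprK natfE mulr1.
Qed.

Lemma X_casimir_x0 k : k != o -> {[X k, casimir]} x0 != 0.
Proof.
move=> /negPf ko; rewrite (bracketC L_antisym) /casimir !leibnizl ?invariantE; auto.
have q1 : sqnorm_q x0 = 1.
  rewrite /sqnorm_q fct_sumE (bigD1 o) //= big1 => [|j /negPf jo];
    by rewrite !fctE !valE ?eqxx ?jo /=; ring.
rewrite !fctE q1 !valE ko (natfE 2) (_ : (0 : V -> R) x0 = 0) //=.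
rewrite [X in X != 0](_ : _ = 2) ?pnatr_eq0 //; ring.
Qed.

Variable o1 : 'I_n.
Hypothesis o1o : o1 != o.

Lemma minor_re_X j k : {[minor_re j, X k]} =
  (o == k)%:R * X j - (j == k)%:R * X o.
Proof. by rewrite /minor_re !leibnizl ?coordE; auto 6; ring. Qed.
Lemma minor_re_Y j k : {[minor_re j, Y k]} =
  (j == k)%:R * Y o - (o == k)%:R * Y j.
Proof.
rewrite /minor_re !leibnizl ?coordE; auto 6; ring.
Qed.
Lemma minor_re_A j k : {[minor_re j, A k]} =
  (o == k)%:R * A j - (j == k)%:R * A o.
Proof. by rewrite /minor_re !leibnizl ?coordE; auto 6; ring. Qed.
Lemma minor_re_B j k : {[minor_re j, B k]} =
  (j == k)%:R * B o - (o == k)%:R * B j.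
Proof. by rewrite /minor_re !leibnizl ?coordE; auto 6; ring. Qed.

Lemma minor_re_minor_re k : k != o -> k != o1 ->
  {[minor_re o1, minor_re k]} x0 = 0.
Proof.
move=> /negPf ko /negPf ko1; rewrite [minor_re k]/minor_re !leibnizr; auto 6.
rewrite !(minor_re_X, minor_re_Y, minor_re_A, minor_re_B) !(eq_sym _ k).
by rewrite ko ko1 !fctE !valE ko !natfE; ring.
Qed.

(** When [w] commutes with [sqminor o1], the Jacobi identity moves it past this
    function, so the differential of [sqminor_bracket] needs no closed form of
    the latter. *)
Lemma sqminor_bracket_coord j w : regular w -> {[sqminor o1, w]} = 0 ->
  {[w, sqminor_bracket o1 j]} = - {[sqminor o1, {[sqminor j, w]}]}.
Proof.
move=> wr w0; rewrite (bracketC L_antisym) /sqminor_bracket bracket_jacobi // w0.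
by rewrite -[0 : V -> R]/(cst 0) (bracket_cstl L_const) add0r.
Qed.

Lemma X_sqminor_bracket k j : k != o -> k != o1 -> k != j ->
  {[X k, sqminor_bracket o1 j]} = 0.
Proof.
move=> ko ko1 kj; rewrite sqminor_bracket_coord //; last exact: sqminor_X.
rewrite sqminor_X //.
by rewrite -[0 : V -> R]/(cst 0) (bracket_cstr L_const) ?oppr0.
Qed.

Lemma A_sqminor_bracket k j : k != o -> k != o1 -> k != j ->
  {[A k, sqminor_bracket o1 j]} = 0.
Proof.
move=> ko ko1 kj; rewrite sqminor_bracket_coord //; last exact: sqminor_A.
rewrite sqminor_A //.
by rewrite -[0 : V -> R]/(cst 0) (bracket_cstr L_const) ?oppr0.
Qed.

(** At [x0] the factor [minor_re k] is 1 and does not vary along the field of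
    [minor_re o1], while [minor_im k] and [g] both vanish; so Leibniz's rule
    leaves only the bracket with [f]. *)
Lemma minor_re_combination k (f g : V -> R) : k != o -> k != o1 ->
  regular f -> regular g -> g x0 = 0 ->
  {[minor_re o1, (minor_re k * f + minor_im k * g) *+ 2]} x0 =
    {[minor_re o1, f]} x0 *+ 2.
Proof.
move=> ko ko1 fr gr g0.
have at_x0 (a b a' b' c d : V -> R) : a x0 = 1 -> b x0 = 0 -> a' x0 = 0 ->
    ((a * c + f * a' + (b * b' + g * d)) *+ 2) x0 = c x0 *+ 2.
  rewrite natmulfctE !fctE => -> -> ->.
  by rewrite g0 !(mul1r, mul0r, mulr0, addr0).
rewrite (bracketMnr L_const L_antisym); last by auto.
rewrite (bracketDr L_const L_antisym); auto.
rewrite !(bracketMr L_const L_antisym _ (regular_minor_re k)) //.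
rewrite !(bracketMr L_const L_antisym _ (regular_minor_im k)) //.
exact: at_x0 (minor_re_x0 ko) (minor_im_x0 k) (minor_re_minor_re ko ko1).
Qed.

Lemma X_sqminor_bracket_x0 k : k != o -> k != o1 ->
  {[X k, sqminor_bracket o1 k]} x0 = 0.
Proof.
move=> ko ko1; rewrite sqminor_bracket_coord //; last exact: sqminor_X.
rewrite sqminor_Xk // opprfctE sqminor_bracket_x0 // (bracketNr L_const) //; last first.
  by apply: regularMn; auto.
rewrite opprfctE minor_re_combination // minor_re_X !fctE !valE (negPf o1o).
by rewrite natfE !(mul0r, mulr0, subr0, mul0rn, oppr0).
Qed.

Lemma A_sqminor_bracket_x0 k : k != o -> k != o1 ->
  {[A k, sqminor_bracket o1 k]} x0 != 0.
Proof.
move=> ko ko1; rewrite sqminor_bracket_coord //; last exact: sqminor_A.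
rewrite sqminor_Ak // opprfctE sqminor_bracket_x0 // (bracketNr L_const) //; last first.
  by apply: regularMn; auto.
rewrite opprfctE minor_re_combination // minor_re_A !fctE !valE.
rewrite !natfE (negPf o1o) eqxx !(mul0r, mulr0, subr0, mulr1) mulrN opprK.
by rewrite -natrM pnatr_eq0.
Qed.

(** ** The two independent families *)

Lemma free_angmom (js : seq 'I_n) : uniq js ->
  free [seq grad h x0 | h <- [seq angmom j | j <- js]].
Proof.
move=> ujs; rewrite -[X in map _ X]cats0.
apply: (free_cat_bracket (L := L) (G := B)) => //=.
- by move=> k _; rewrite B_angmom_x0 eqxx oner_neq0.
- by move=> k j _ _ /negPf jk; rewrite B_angmom_x0 jk.
- exact: nil_free.
Qed.

Lemma sqnorm_q_x0 f : quad_invariant f -> {[sqnorm_q, f]} x0 = 0.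
Proof. by case=> ->. Qed.

Lemma free_integrals1 (js : seq 'I_n) : uniq js ->
  free [seq grad h x0 | h <- hamiltonian :: [seq angmom j | j <- js]].
Proof.
move=> ujs; apply: (free_cons_bracket (g := sqnorm_q) sqnorm_q_hamiltonian_x0).
  by move=> _ /mapP[j _ ->]; apply: sqnorm_q_x0; exact: quad_invariant_angmom.
exact: free_angmom.
Qed.

Lemma free_center (js : seq 'I_n) : uniq js ->
  free [seq grad h x0 | h <- hamiltonian :: casimir :: [seq angmom j | j <- js]].
Proof.
move=> ujs; apply: (free_cons_bracket (g := sqnorm_q) sqnorm_q_hamiltonian_x0).
  move=> h; rewrite inE => /predU1P[->|/mapP[j _ ->]].
    by have [-> _ _] := casimir_invariant.
  by apply: sqnorm_q_x0; exact: quad_invariant_angmom.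
apply: (free_cons_bracket (g := X o1)).
- exact: X_casimir_x0.
- by move=> _ /mapP[j _ ->]; exact: X_angmom_x0.
- exact: free_angmom.
Qed.

(** The order of the list makes the Jacobian at [x0] triangular.  The function
    |q|^2 sees only the Hamiltonian; for [k] other than [o] and [o1], [X k]
    sees only [sqminor k], and then [A k] sees only [sqminor_bracket o1 k].
    After that [X o1] sees [sqminor o1], and [B k] sees [angmom k]. *)
Lemma free_integrals (ks js : seq 'I_n) : uniq js -> uniq ks ->
  o \notin ks -> o1 \notin ks ->
  free [seq grad h x0 | h <- hamiltonian :: [seq sqminor k | k <- ks] ++
    [seq sqminor_bracket o1 k | k <- ks] ++ sqminor o1 :: [seq angmom j | j <- js]].
Proof.
move=> ujs uks oks o1ks.
have kso k : k \in ks -> k != o by apply: contraTneq => ->.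
have kso1 k : k \in ks -> k != o1 by apply: contraTneq => ->.
apply: (free_cons_bracket (g := sqnorm_q) sqnorm_q_hamiltonian_x0).
  have sqminorq k : {[sqnorm_q, sqminor k]} = 0 by case: (quad_invariant_sqminor k).
  move=> h; rewrite !mem_cat inE => /orP[/mapP[k _ ->]|].
    by rewrite sqminorq.
  case/orP=> [/mapP[k _ ->]|/predU1P[->|/mapP[j _ ->]]].
  - rewrite (bracketC L_antisym) /sqminor_bracket bracket_jacobi // opprfctE.
    rewrite !(bracket0C L_antisym (sqminorq _)) -[0 : V -> R]/(cst 0).
    by rewrite (bracket_cstl L_const) (bracket_cstr L_const) // addr0 oppr0.
  - by rewrite sqminorq.
  - by apply: sqnorm_q_x0; exact: quad_invariant_angmom.
apply: (free_cat_bracket (L := L) (G := X)) => //.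
- by move=> k /kso; exact: X_sqminor_x0.
- by move=> k j /kso ko _ jk; rewrite X_sqminor // eq_sym.
- move=> k h kks; have [ko ko1] := (kso k kks, kso1 k kks).
  rewrite mem_cat inE => /orP[/mapP[j _ ->]|/predU1P[->|/mapP[j _ ->]]].
  + have [->|kj] := eqVneq j k; first exact: X_sqminor_bracket_x0.
    by rewrite X_sqminor_bracket // eq_sym.
  + by rewrite X_sqminor.
  + exact: X_angmom_x0.
apply: (free_cat_bracket (L := L) (G := A)) => //.
- by move=> k kks; apply: A_sqminor_bracket_x0; [exact: kso|exact: kso1].
- move=> k j kks _ jk; rewrite A_sqminor_bracket ?kso ?kso1 //.
  by rewrite eq_sym.
- move=> k h kks; rewrite inE => /predU1P[->|/mapP[j _ ->]].
    by rewrite A_sqminor ?kso ?kso1.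
  exact: A_angmom_x0.
apply: (free_cons_bracket (g := X o1)).
- exact: X_sqminor_x0.
- by move=> _ /mapP[j _ ->]; exact: X_angmom_x0.
- exact: free_angmom.
Qed.

End CanonicalCoordinates.

(** * The reduced system *)

Section ReducedSystem.
Variables (R : realType) (n : nat) (C : R).
Notation V := 'rV[R]_((n + n) + (n + n)).
Notation L := (@LR_poisson R n C).
Notation "{[ f , g ]}" := (bracket L f g) (format "{[ f ,  g ]}").

Definition coord_x (k : 'I_n) (z : V) : R := z 0 (lshift (n + n) (lshift n k)).
Definition coord_y (k : 'I_n) (z : V) : R := z 0 (lshift (n + n) (rshift n k)).
Definition coord_a (k : 'I_n) (z : V) : R := z 0 (rshift (n + n) (lshift n k)).
Definition coord_b (k : 'I_n) (z : V) : R := z 0 (rshift (n + n) (rshift n k)).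

(** With [C] the strength of a constant magnetic field in each plane, this
    subtracts its symmetric vector potential, which makes all four families
    canonical. *)
Definition canon_a k : V -> R := coord_a k - cst (C / 2) * coord_y k.
Definition canon_b k : V -> R := coord_b k + cst (C / 2) * coord_x k.

Lemma L_const (z : V) : L z = L 0. Proof. by []. Qed.
Definition L_antisym := @LR_poisson_antisym R n C.
Definition L_unit := @LR_poisson_nondegenerate R n C.

Lemma regular_x k : regular (coord_x k). Proof. exact: regular_coord. Qed.
Lemma regular_y k : regular (coord_y k). Proof. exact: regular_coord. Qed.
Lemma regular_coord_a k : regular (coord_a k).
Proof. exact: regular_coord. Qed.
Lemma regular_coord_b k : regular (coord_b k).
Proof. exact: regular_coord. Qed.
#[local] Hint Resolve regular_x regular_y regular_coord_a regular_coord_b : core.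
Lemma regular_a k : regular (canon_a k). Proof. by rewrite /canon_a; auto. Qed.
Lemma regular_b k : regular (canon_b k). Proof. by rewrite /canon_b; auto. Qed.

Ltac coordinate_bracket :=
  rewrite (bracket_coord L_const) /LR_poisson;
  rewrite ?(block_mxEul, block_mxEur, block_mxEdl, block_mxEdr) !mxE;
  rewrite ?(inj_eq (@lshift_inj _ _), inj_eq (@rshift_inj _ _)) ?eq_lrshift ?eq_rlshift;
  apply/funext => z; rewrite ?natmulfctE //.

Lemma bracket_xx j k : {[coord_x j, coord_x k]} = 0.
Proof. by coordinate_bracket. Qed.
Lemma bracket_xy j k : {[coord_x j, coord_y k]} = 0.
Proof. by coordinate_bracket. Qed.
Lemma bracket_yy j k : {[coord_y j, coord_y k]} = 0.
Proof. by coordinate_bracket. Qed.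
Lemma bracket_xa j k : {[coord_x j, coord_a k]} = (j == k)%:R.
Proof. by coordinate_bracket. Qed.
Lemma bracket_xb j k : {[coord_x j, coord_b k]} = 0.
Proof. by coordinate_bracket. Qed.
Lemma bracket_ya j k : {[coord_y j, coord_a k]} = 0.
Proof. by coordinate_bracket. Qed.
Lemma bracket_yb j k : {[coord_y j, coord_b k]} = (j == k)%:R.
Proof. by coordinate_bracket. Qed.
Lemma bracket_aa j k : {[coord_a j, coord_a k]} = 0.
Proof. by coordinate_bracket. Qed.
Lemma bracket_ab j k : {[coord_a j, coord_b k]} = cst C * (j == k)%:R.
Proof. by coordinate_bracket; rewrite -mulr_natr. Qed.
Lemma bracket_bb j k : {[coord_b j, coord_b k]} = 0.
Proof. by coordinate_bracket. Qed.

#[local] Hint Resolve regular_a regular_b : core.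

Let bracket_ax j k : {[coord_a j, coord_x k]} = - (j == k)%:R.
Proof. by rewrite (bracketC L_antisym) bracket_xa eq_sym. Qed.
Let bracket_bx j k : {[coord_b j, coord_x k]} = 0.
Proof. by apply: (bracket0C L_antisym); rewrite bracket_xb. Qed.
Let bracket_ay j k : {[coord_a j, coord_y k]} = 0.
Proof. by apply: (bracket0C L_antisym); rewrite bracket_ya. Qed.
Let bracket_yx j k : {[coord_y j, coord_x k]} = 0.
Proof. by apply: (bracket0C L_antisym); rewrite bracket_xy. Qed.

Ltac canonical_bracket :=
  rewrite /canon_a /canon_b;
  match goal with |- context [@cst ?T ?U (C / 2)] =>
    let c := fresh "c" in set (c := @cst T U (C / 2));
    assert (cr : regular c) by exact: regular_cst;
    assert (c0 : forall f, {[c, f]} = 0) by exact: (bracket_cstl L_const);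
    assert (c0' : forall f, {[f, c]} = 0)
      by exact: (bracket_cstr L_const L_antisym);
    clearbody c
  end;
  rewrite ?(bracketDl L_const, bracketDr L_const L_antisym, bracketNl L_const,
    bracketNr L_const L_antisym, bracketMl L_const, bracketMr L_const L_antisym);
  auto;
  repeat match goal with H : forall f, _ = 0 |- _ => rewrite ?H; clear H end;
  rewrite ?(bracket_xx, bracket_xy, bracket_yy, bracket_xa, bracket_xb,
    bracket_ya, bracket_yb, bracket_aa, bracket_ab, bracket_bb, bracket_ax,
    bracket_bx, bracket_ay, bracket_yx).

Lemma canonical_xa j k : {[coord_x j, canon_a k]} = (j == k)%:R.
Proof. by canonical_bracket; ring. Qed.
Lemma canonical_xb j k : {[coord_x j, canon_b k]} = 0.
Proof. by canonical_bracket; ring. Qed.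
Lemma canonical_ya j k : {[coord_y j, canon_a k]} = 0.
Proof. by canonical_bracket; ring. Qed.
Lemma canonical_yb j k : {[coord_y j, canon_b k]} = (j == k)%:R.
Proof. by canonical_bracket; ring. Qed.
Lemma canonical_aa j k : {[canon_a j, canon_a k]} = 0.
Proof. by canonical_bracket; ring. Qed.
Lemma canonical_bb j k : {[canon_b j, canon_b k]} = 0.
Proof.
by canonical_bracket; ring.
Qed.
Lemma canonical_ab j k : {[canon_a j, canon_b k]} = 0.
Proof.
have : cst (C / 2) + cst (C / 2) = cst C :> (V -> R).
  by apply/funext => z; rewrite !fctE -splitr.
by canonical_bracket => <-; rewrite ?(eq_sym k); ring.
Qed.

Lemma canonical_reduced : canonical_coordinates L
  (@coord_x) (@coord_y) (@canon_a) (@canon_b).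
Proof.
split; [exact: regular_x | exact: regular_y | exact: regular_a | exact: regular_b
  | exact: bracket_xx | exact: bracket_xy | exact: bracket_yy
  | exact: canonical_xa | exact: canonical_xb | exact: canonical_ya
  | exact: canonical_yb | exact: canonical_aa | exact: canonical_ab
  | exact: canonical_bb].
Qed.

Definition sq_q := sqnorm_q (@coord_x) (@coord_y).

Lemma sq_q_ge0 z : 0 <= sq_q z.
Proof.
rewrite /sq_q /sqnorm_q fct_sumE; apply: sumr_ge0 => k _.
by rewrite !fctE -!expr2 addr_ge0 ?sqr_ge0.
Qed.

Lemma one_sq_q_neq0 z : (1 + sq_q) z != 0.
Proof. by rewrite gt_eqF // fctE ltr_pwDl ?ltr01 ?sq_q_ge0. Qed.

Definition inv_1q z : R := ((1 + sq_q) z)^-1.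

Lemma regular_sq_q : regular sq_q.
Proof. exact: regular_sqnorm_q canonical_reduced. Qed.

Lemma regular_1q : regular (1 + sq_q).
Proof. exact: regularD (regular1 _ _) regular_sq_q. Qed.

Lemma regular_inv_1q : regular inv_1q.
Proof. exact: regularV regular_1q one_sq_q_neq0. Qed.

Lemma bracket_inv_1q f : {[inv_1q, f]} = - (inv_1q * inv_1q * {[sq_q, f]}).
Proof.
have qr := regular_sq_q.
rewrite [LHS](bracketVl L_const f regular_1q one_sq_q_neq0).
by rewrite (bracketDl L_const) // -[1 : V -> R]/(cst 1) (bracket_cstl L_const) add0r.
Qed.

Lemma HC_hamiltonian : @HC R n =
  hamiltonian (@coord_x) (@coord_y) (@canon_a) (@canon_b) C inv_1q.
Proof.
apply/funext => z.
have dotE m (u v : 'rV[R]_m) : dot u v = \sum_i u 0 i * v 0 i.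
  by rewrite /dot mxE; apply: eq_bigr => i _; rewrite mxE.
have qq : dot (lsubmx z) (lsubmx z) = sq_q z.
  rewrite dotE big_split_ord /= /sq_q /sqnorm_q fct_sumE -big_split /=.
  by apply: eq_bigr => k _; rewrite !mxE.
have pp : dot (rsubmx z) (rsubmx z) =
    \sum_k (coord_a k z * coord_a k z + coord_b k z * coord_b k z).
  rewrite dotE big_split_ord /= -big_split /=.
  by apply: eq_bigr => k _; rewrite !mxE.
have qp : omega (lsubmx z) (rsubmx z) =
    \sum_k (coord_y k z * coord_a k z - coord_x k z * coord_b k z).
  rewrite /omega -[lsubmx z in LHS]hsubmxK -[rsubmx z in LHS]hsubmxK.
  rewrite /Jmx mul_row_block tr_row_mx mul_row_col !mulmx0 add0r addr0.
  rewrite mulmxN !mulmx1 mulNmx !mxE -sumrB.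
  by apply: eq_bigr => k _; rewrite !mxE.
rewrite /HC qq pp qp /hamiltonian !fctE -/sq_q.
congr (_ * (_ - _)).
  rewrite /sq_q /sqnorm_q /sqnorm_p /omega_qp !fct_sumE !mulr_sumr.
  rewrite -!big_split /=; apply: eq_bigr => k _.
  by rewrite /canon_a /canon_b !fctE; field.
rewrite -expr2; congr (_ ^+ 2 * _).
  rewrite /sq_q /sqnorm_q /omega_qp !fct_sumE !mulr_sumr.
  rewrite -!big_split /=; apply: eq_bigr => k _.
  by rewrite /canon_a /canon_b !fctE; field.
Qed.

(** Since the canonical momenta are to be 1 and 0, the last block compensates
    the vector potential of the only nonzero coordinate. *)
Definition base_point (o : 'I_n) : V :=
  row_mx (row_mx (\row_k (k == o)%:R) 0)
         (row_mx (const_mx 1) (\row_k - (C / 2 * (k == o)%:R))).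

Lemma base_x o k : coord_x k (base_point o) = (k == o)%:R.
Proof. by rewrite /coord_x !row_mxEl mxE. Qed.
Lemma base_y o k : coord_y k (base_point o) = 0.
Proof. by rewrite /coord_y row_mxEl row_mxEr mxE. Qed.
Lemma base_a o k : canon_a k (base_point o) = 1.
Proof.
rewrite /canon_a !fctE base_y mulr0 subr0 /coord_a row_mxEr row_mxEl mxE //.
Qed.
Lemma base_b o k : canon_b k (base_point o) = 0.
Proof.
by rewrite /canon_b !fctE base_x /coord_b !row_mxEr mxE addNr.
Qed.

Definition moment_angmom k : V -> R :=
  angmom (@coord_x) (@coord_y) (@canon_a) (@canon_b) k.
Definition moment_minor o k : V -> R :=
  sqminor (@coord_x) (@coord_y) (@canon_a) (@canon_b) o k.
Definition moment_casimir : V -> R :=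
  casimir (@coord_x) (@coord_y) (@canon_a) (@canon_b).
Definition moment_minor_bracket o j k : V -> R := {[moment_minor o j, moment_minor o k]}.

Let center f :=
  commutes_with_center L (@coord_x) (@coord_y) (@canon_a) (@canon_b) C inv_1q f.

(** The hypotheses of [complete_of_center], apart from independence, for any
    selection from the two families; the selections depend on whether [n] is
    1. *)
Lemma integrals_properties (o : 'I_n) (s cs : seq (V -> R)) :
  (forall f, f \in s -> [\/ f = @HC R n, exists k, f = moment_angmom k,
     exists k, f = moment_minor o k | exists j k, f = moment_minor_bracket o j k]) ->
  (forall f, f \in cs -> [\/ f = @HC R n, exists k, f = moment_angmom k
     | f = moment_casimir]) ->
  [/\ forall f, f \in s -> regular f, forall c, c \in cs -> regular c,
      forall f c, f \in s -> c \in cs -> {[f, c]} = 0 &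
      forall c d, c \in cs -> d \in cs -> {[c, d]} = 0].
Proof.
move=> sP csP; have cr := canonical_reduced.
have HCr : regular (@HC R n).
  by rewrite HC_hamiltonian; exact: (regular_hamiltonian cr C regular_inv_1q).
have rr k : regular (moment_angmom k) by exact: regular_angmom cr k.
have cc f c : center f -> c \in cs -> {[f, c]} = 0.
  move=> [fH f_angmom fK] /csP[->|[k ->]|->]; [|exact: f_angmom|exact: fK].
  by rewrite HC_hamiltonian; exact: fH.
have HCc : center (@HC R n).
  rewrite HC_hamiltonian.
  exact (hamiltonian_commutes L_const L_antisym cr C regular_inv_1q bracket_inv_1q).
have rc k : center (moment_angmom k).
  exact (angmom_commutes L_const L_antisym cr C regular_inv_1q bracket_inv_1q k).
split.
- move=> f /sP[->|[k ->]|[k ->]|[j [k ->]]].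
  + exact: HCr.
  + exact: rr.
  + exact: regular_sqminor cr o k.
  + exact (regular_sqminor_bracket L_const cr o j k).
- move=> c /csP[->|[k ->]|->]; [exact: HCr|exact: rr|].
  exact: regular_casimir cr.
- move=> f c /sP fP ccs; apply: (cc _ _ _ ccs).
  case: fP => [->|[k ->]|[k ->]|[j [k ->]]]; [exact: HCc|exact: rc| |].
  + exact (sqminor_commutes L_const L_antisym cr C regular_inv_1q bracket_inv_1q o k).
  + exact (sqminor_bracket_commutes L_const L_antisym cr C regular_inv_1q
      bracket_inv_1q o j k).
- move=> c d /csP cP dcs; apply: (cc _ _ _ dcs).
  case: cP => [->|[k ->]|->]; [exact: HCc|exact: rc|].
  exact (casimir_commutes L_const L_antisym cr C regular_inv_1q bracket_inv_1q).
Qed.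

Lemma free_reduced_integrals1 o (js : seq 'I_n) : uniq js ->
  free [seq grad h (base_point o) | h <- @HC R n :: [seq moment_angmom j | j <- js]].
Proof.
rewrite HC_hamiltonian => js_uniq.
exact (free_integrals1 L_const L_antisym canonical_reduced C regular_inv_1q
  bracket_inv_1q (base_x o) (base_y o) (base_a o) (base_b o) js_uniq).
Qed.

Lemma free_reduced_center o o1 (js : seq 'I_n) : o1 != o -> uniq js ->
  free [seq grad h (base_point o) |
    h <- @HC R n :: moment_casimir :: [seq moment_angmom j | j <- js]].
Proof.
rewrite HC_hamiltonian => o1o js_uniq.
exact (free_center L_const L_antisym canonical_reduced C regular_inv_1q
  bracket_inv_1q (base_x o) (base_y o) (base_a o) (base_b o) o1o js_uniq).
Qed.

Lemma free_reduced_integrals o o1 (ks js : seq 'I_n) : o1 != o ->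
  uniq js -> uniq ks -> o \notin ks -> o1 \notin ks ->
  free [seq grad h (base_point o) |
    h <- @HC R n :: [seq moment_minor o k | k <- ks] ++
         [seq moment_minor_bracket o o1 k | k <- ks] ++
         moment_minor o o1 :: [seq moment_angmom j | j <- js]].
Proof.
rewrite HC_hamiltonian => o1o js_uniq ks_uniq oks o1ks.
exact (free_integrals L_const L_antisym canonical_reduced C regular_inv_1q
  bracket_inv_1q (base_x o) (base_y o) (base_a o) (base_b o) o1o js_uniq ks_uniq
  oks o1ks).
Qed.

End ReducedSystem.

(** * The sequence of first integrals *)

Section Integrals.
Variables (R : realType) (m : nat) (C : R).
Notation n := m.+1.
Notation V := 'rV[R]_((n + n) + (n + n)).

Definition integral_I (i : nat) : V -> R :=
  if i == 0%N then @HC R n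
  else if (i <= n)%N then moment_angmom C (inord i.-1)
  else moment_minor C ord0 (inord (i - n)).

Definition integral_J (k : nat) : V -> R :=
  moment_minor_bracket C ord0 (inord 1) (inord k).

Definition integrals : seq (V -> R) :=
  [seq integral_I i | i <- iota 0 (2 * n)] ++
  [seq integral_J k | k <- iota 2 (n - 2)].

Lemma integralsE : integrals = @HC R n ::
  [seq moment_angmom C j | j <- [seq inord i | i <- iota 0 n]] ++
  [seq moment_minor C ord0 k | k <- [seq inord i | i <- iota 1 m]] ++
  [seq moment_minor_bracket C ord0 (inord 1) k | k <- [seq inord i | i <- iota 2 m.-1]].
Proof.
rewrite /integrals -!map_comp (_ : 2 * n = 1 + (n + m))%N; last by lia.
rewrite (_ : (n - 2)%N = m.-1); last by lia.
have angmoms : [seq integral_I i | i <- iota (0 + 1) n] =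
    [seq (moment_angmom C \o inord) i | i <- iota 0 n].
  rewrite addnC iotaDl -map_comp; apply/eq_in_map => i.
  by rewrite mem_iota /integral_I => /andP[_ /= ->].
have minors : [seq integral_I i | i <- iota (0 + 1 + n) m] =
    [seq (moment_minor C ord0 \o inord) i | i <- iota 1 m].
  rewrite add0n addnC iotaDl -map_comp; apply/eq_in_map => i.
  rewrite mem_iota /integral_I => /andP[i_gt0 _] /=.
  by rewrite -[X in (_ <= X)%N]addn0 leq_add2l leqNgt i_gt0 addKn.
by rewrite iotaD map_cat iotaD map_cat angmoms minors -!catA.
Qed.

Lemma inord_inj (s : seq nat) : {subset s <= gtn n} -> uniq s ->
  uniq [seq inord i : 'I_n | i <- s].
Proof.
move=> sn us; rewrite map_inj_in_uniq // => i j /sn i_n /sn j_n.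
by move=> /(congr1 val); rewrite /= !inordK.
Qed.

Lemma mem_inord (s : seq nat) (k : nat) : (k < n)%N -> {subset s <= gtn n} ->
  (inord k : 'I_n) \in [seq inord i : 'I_n | i <- s] -> k \in s.
Proof.
move=> kn sn /mapP[i si /(congr1 val)]; rewrite /= !inordK //.
  by move=> ->.
exact: sn.
Qed.

Lemma iota_gtn a b : (a + b <= n)%N -> {subset iota a b <= gtn n}.
Proof. by move=> abn i; rewrite mem_iota inE => /andP[_ /leq_trans]; apply. Qed.

(** For [n] = 1 there are no 2x2 minors and the Casimir function vanishes, so it
    is left out: the test [0 < m], read as a length, makes the middle list empty
    in that case. *)
Definition center_integrals : seq (V -> R) :=
  @HC R n :: [seq moment_casimir C | _ <- iota 0 (0 < m)] ++
  [seq moment_angmom C j | j <- [seq inord i | i <- iota 0 n]].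

Lemma center_integrals_commute :
  [/\ forall f, f \in integrals -> regular f,
      forall c, c \in center_integrals -> regular c,
      forall f c, f \in integrals -> c \in center_integrals ->
        bracket (@LR_poisson R n C) f c = 0 &
      forall c d, c \in center_integrals -> d \in center_integrals ->
        bracket (@LR_poisson R n C) c d = 0].
Proof.
apply: (integrals_properties (C := C) (o := ord0)).
  move=> f; rewrite integralsE inE !mem_cat.
  case/predU1P => [->|]; first by constructor.
  by case/or3P => /mapP[k _ ->]; [constructor 2|constructor 3|constructor 4];
    [exists k|exists k|exists (inord 1), k].
move=> f; rewrite inE mem_cat; case/predU1P => [->|]; first by constructor.
by case/orP => /mapP[k _ ->]; [constructor 3|constructor 2; exists k].
Qed.

(** For [n] at most 2 there is at most one minor, so the integrals are all in
    the commuting family except for this one. *)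
Lemma integrals_commute : (n <= 2)%N ->
  forall f g, f \in integrals -> g \in integrals ->
    bracket (@LR_poisson R n C) f g = 0.
Proof.
move=> n2; have [_ _ comm _] := center_integrals_commute.
have intP f : f \in integrals ->
    f \in center_integrals \/ f = moment_minor C ord0 (inord 1).
  rewrite integralsE in_cons !mem_cat.
  case/predU1P => [->|]; first by left; rewrite in_cons eqxx.
  case/or3P => [f_angmom|/mapP[j jI ->]|/mapP[j jI _]].
  - by left; rewrite in_cons mem_cat f_angmom !orbT.
  - case/mapP: jI => k; rewrite mem_iota => k_m ->; right.
    by rewrite (_ : k = 1%N) //; lia.
  - by case/mapP: jI => k; rewrite mem_iota; lia.
move=> f g fI gI; case: (intP g gI) => [|gE]; first exact: comm.
case: (intP f fI) => [fc|->].
  by apply: (bracket0C (@L_antisym R n C)); exact: comm.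
by rewrite gE (bracketff (@L_antisym R n C)).
Qed.

Theorem reduced_integrals_complete :
  let F := lie_generated (@LR_poisson R n C) [set` integrals] in
  [/\ is_ddim F (size integrals),
      forall f, f \in integrals ->
        first_integral (@LR_poisson R n C) (@HC R n) f,
      generically_independent integrals &
      complete_algebra (@LR_poisson R n C) (@HC R n) F].
Proof.
have [r1 r2 comm ccomm] := center_integrals_commute.
have js_uniq : uniq [seq inord i : 'I_n | i <- iota 0 n].
  by apply: inord_inj; [exact: iota_gtn|exact: iota_uniq].
have sizes : (size integrals + size center_integrals)%N = (n + n + (n + n))%N.
  rewrite integralsE /= !size_cat !size_map !size_iota.
  by case: m => [|m'] /=; rewrite ?size_map ?size_iota; lia.
apply: (complete_of_center (@L_const R n C) (@L_antisym R n C)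
  (@L_unit R n C) (x0 := base_point C ord0) r1 r2 comm ccomm) => //.
- by rewrite inE eqxx.
- case: (posnP m) => [m0|m_gt0].
    by move: js_uniq; rewrite integralsE m0; exact: free_reduced_integrals1.
  have m_1 : m = (1 + m.-1)%N by lia.
  pose js := [seq inord i : 'I_n | i <- iota 0 n].
  pose ks := [seq inord i : 'I_n | i <- iota 2 m.-1].
  pose o1 : 'I_n := inord 1.
  have sub_ks : {subset iota 2 m.-1 <= gtn n} by apply: iota_gtn; lia.
  rewrite (perm_free (Y := [seq grad h (base_point C ord0) | h <- @HC R n ::
    [seq moment_minor C ord0 k | k <- ks] ++
    [seq moment_minor_bracket C ord0 o1 k | k <- ks] ++
    moment_minor C ord0 o1 :: [seq moment_angmom C j | j <- js]])).
    apply: free_reduced_integrals => //.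
    + by rewrite -val_eqE /= inordK.
    + by apply: inord_inj; [exact: sub_ks|exact: iota_uniq].
    + apply/negP => /mapP[k]; rewrite mem_iota => /andP[k2 km] /(congr1 val) /=.
      by rewrite inordK; lia.
    + by apply/negP => /mem_inord; rewrite mem_iota => /(_ _ sub_ks); lia.
  apply: perm_map; rewrite integralsE perm_cons -/js -/ks.
  move: [seq moment_angmom C j | j <- js] => rs.
  rewrite [in iota 1 m]m_1 iotaD !map_cat -/ks /=.
  rewrite [in X in perm_eq _ X]catA perm_catC /= -[_ :: rs]cat1s.
  exact: (permEl (perm_catCA [:: moment_minor C ord0 o1] _ _)).
- rewrite /center_integrals; case: (posnP m) => [m0|m_gt0].
    exact: free_reduced_integrals1.
  have o1_neq : inord 1 != ord0 :> 'I_n by rewrite -val_eqE /= inordK.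
  exact: (free_reduced_center C o1_neq js_uniq).
Qed.

End Integrals.

(** * Hyperspherical coordinates *)

Section Hyperspherical.
Variables (R : realType) (n : nat).
Implicit Types (r t : R) (theta : nat -> R).

Lemma derive1_mulr (f : R -> R) (df c x : R) :
  is_derive x 1 f df -> derive1 (fun t => f t * c) x = df * c.
Proof.
move=> fx; rewrite derive1E.
have -> : (fun t => f t * c) = c *: f by apply/funext => t; rewrite fctE mulrC.
by rewrite deriveZ //= derive_val mulrC.
Qed.

(** Counting radii from 0 gives both cases the same product of cosines. *)
Lemma hs_radE k r theta : (k < n)%N -> hs_rad n k.+1 r theta =
  r * (\prod_(1 <= j < n - k) cos (theta j)) *
  (if k == 0%N then 1 else sin (theta (n - k)%N)).
Proof.
move=> kn; rewrite /hs_rad eqSS; case: k kn => [|k] kn /=.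
  by rewrite subn0 mulr1.
by rewrite subnSK // addn1 subnSK.
Qed.

Lemma with_self theta (m : nat) :
  ([eta theta with m |-> theta m] : nat -> R) = theta.
Proof. by apply/funext => j /=; case: eqP => [->|]. Qed.

Lemma prod_cos_with theta m t b : (1 <= m < b)%N ->
  \prod_(1 <= j < b) cos ([eta theta with m |-> t] j) =
  cos t * \prod_(1 <= j < b | j != m) cos (theta j).
Proof.
move=> mb; rewrite (bigD1_seq m) ?mem_index_iota ?iota_uniq //= eqxx.
by congr (_ * _); apply: eq_bigr => j /negPf ->.
Qed.

Lemma prod_cos_with_out theta m t b : (b <= m)%N ->
  \prod_(1 <= j < b) cos ([eta theta with m |-> t] j) =
  \prod_(1 <= j < b) cos (theta j).
Proof.
move=> bm; apply: eq_big_nat => j /andP[_ jb] /=.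
by rewrite ltn_eqF // (leq_trans jb).
Qed.

(** Logarithmic derivative of the [k]-th radius (counted from 0) with respect
    to the [m]-th angle. *)
Definition hs_slope m k theta : R :=
  if (k < n - m)%N then - tan (theta m)
  else if (k == n - m)%N then (tan (theta m))^-1 else 0.

Lemma is_derive_hs_rad m k r theta : (1 <= m < n)%N -> (k < n)%N ->
  cos (theta m) != 0 -> sin (theta m) != 0 ->
  is_derive (theta m) 1 (fun t => hs_rad n k.+1 r [eta theta with m |-> t])
    (hs_slope m k theta * hs_rad n k.+1 r theta).
Proof.
move=> /andP[m_gt0 mn] kn cm sm.
have radE : hs_rad n k.+1 r theta = hs_rad n k.+1 r [eta theta with m |-> theta m].
  by rewrite with_self.
rewrite radE /hs_slope; case: ifPn => [k_lt|].
  pose c := r * (\prod_(1 <= j < n - k | j != m) cos (theta j)) *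
    (if k == 0%N then 1 else sin (theta (n - k)%N)).
  have fE t : hs_rad n k.+1 r [eta theta with m |-> t] = c * cos t.
    rewrite hs_radE // prod_cos_with; last by lia.
    rewrite /= (_ : (n - k == m)%N = false); last by lia.
    rewrite /c; set s := (if _ then _ else _); set P := \prod_(1 <= j < _ | _) _.
    by clearbody s P; ring.
  rewrite fE (_ : (fun t => _) = c *: (@cos R)); last first.
    by apply/funext => t; rewrite fE.
  rewrite [X in is_derive _ _ _ X](_ : _ = c * - sin (theta m)).
    exact: (is_deriveZ c (is_derive_cos _)).
  by rewrite /tan; clearbody c; field.
rewrite -leqNgt => k_ge; case: eqP => [k_eq|k_neq].
  pose c := r * (\prod_(1 <= j < n - k) cos (theta j)).
  have fE t : hs_rad n k.+1 r [eta theta with m |-> t] = c * sin t.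
    rewrite hs_radE // prod_cos_with_out; last by lia.
    rewrite /= (_ : (n - k == m)%N = true); last by lia.
    by rewrite (_ : (k == 0)%N = false) //; lia.
  rewrite fE (_ : (fun t => _) = c *: (@sin R)); last first.
    by apply/funext => t; rewrite fE.
  rewrite [X in is_derive _ _ _ X](_ : _ = c * cos (theta m)).
    exact: (is_deriveZ c (is_derive_sin _)).
  by rewrite /tan; clearbody c; field; rewrite cm sm.
rewrite mul0r (_ : (fun t => _) = cst (hs_rad n k.+1 r theta)).
  exact: is_derive_cst.
apply/funext => t; rewrite !hs_radE // prod_cos_with_out; last by lia.
rewrite /= (_ : (n - k == m)%N = false) //; lia.
Qed.

Lemma hs_rad_angle j k r theta t : (n <= j)%N -> (k < n)%N ->
  hs_rad n k.+1 r [eta theta with j |-> t] = hs_rad n k.+1 r theta.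
Proof.
move=> nj kn; rewrite !hs_radE // prod_cos_with_out; last by lia.
case: eqP => [//|k0] /=.
by rewrite (_ : (n - k == j)%N = false) //; lia.
Qed.

Variables (r : R) (theta : nat -> R) (p : 'rV[R]_(n + n)).
Hypothesis reg : hs_regular n r theta.

Definition hs_x (k : 'I_n) : R := hs_rad n k.+1 r theta * cos (theta (n + k)%N).
Definition hs_y (k : 'I_n) : R := hs_rad n k.+1 r theta * sin (theta (n + k)%N).
Definition hs_a (k : 'I_n) : R := p 0 (lshift n k).
Definition hs_b (k : 'I_n) : R := p 0 (rshift n k).

(** The angular momentum and the product [rho * p_rho] in the [k]-th plane. *)
Definition hs_ang k : R := hs_x k * hs_b k - hs_y k * hs_a k.
Definition hs_dil k : R := hs_x k * hs_a k + hs_y k * hs_b k.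

Lemma hs_pthetaE j : hs_ptheta r theta p j =
  \sum_k (hs_a k * derive1 (fun t => hs_rad n k.+1 r [eta theta with j |-> t]
            * cos ([eta theta with j |-> t] (n + k)%N)) (theta j) +
          hs_b k * derive1 (fun t => hs_rad n k.+1 r [eta theta with j |-> t]
            * sin ([eta theta with j |-> t] (n + k)%N)) (theta j)).
Proof.
rewrite /hs_ptheta big_split_ord /= -big_split /=; apply: eq_bigr => k _.
congr (_ * _ + _ * _).
  by congr derive1; apply/funext => t; rewrite /hs_q row_mxEl mxE.
by congr derive1; apply/funext => t; rewrite /hs_q row_mxEr mxE.
Qed.

Lemma hs_ptheta_angle (k : 'I_n) : hs_ptheta r theta p (n + k) = hs_ang k.
Proof.
have der (f df : R -> R) (j : 'I_n) : (forall t : R, is_derive t 1 f (df t)) ->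
    derive1 (fun t => hs_rad n j.+1 r [eta theta with (n + k)%N |-> t] *
      f ([eta theta with (n + k)%N |-> t] (n + j)%N)) (theta (n + k)%N) =
    if j == k then hs_rad n j.+1 r theta * df (theta (n + k)%N) else 0.
  move=> fd; have -> : (fun t => hs_rad n j.+1 r [eta theta with (n + k)%N |-> t] *
      f ([eta theta with (n + k)%N |-> t] (n + j)%N)) =
      (fun t => (if j == k then f t else f (theta (n + j)%N)) *
        hs_rad n j.+1 r theta).
    apply/funext => t; rewrite hs_rad_angle ?leq_addr //= eqn_add2l val_eqE.
    by rewrite mulrC; case: ifP.
  case: eqP => _; first by rewrite (derive1_mulr _ (fd _)) mulrC.
  exact: (derive1_cst (f (theta (n + j)%N) * hs_rad n j.+1 r theta)).
rewrite hs_pthetaE.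
under eq_bigr => j _ do
  rewrite (der _ _ j (@is_derive_cos R)) (der _ _ j (@is_derive_sin R)).
rewrite (bigD1 k) //= eqxx big1 => [|j /negPf ->]; last by rewrite !mulr0 addr0.
by rewrite /hs_ang /hs_x /hs_y; ring.
Qed.

(** The angle [theta m] moves only radii, along which the polar angles are
    fixed; so each plane contributes rho p_rho times the slope. *)
Lemma hs_ptheta_radial (m : nat) : (1 <= m < n)%N ->
  hs_ptheta r theta p m = \sum_(k < n) hs_slope m k theta * hs_dil k.
Proof.
move=> mn; have /andP[_ m_lt] := mn; have [_ /(_ m mn) [cm sm]] := reg.
rewrite hs_pthetaE; apply: eq_bigr => k _.
have nkm : (n + k == m)%N = false by lia.
rewrite /= nkm.
have slope := is_derive_hs_rad r mn (ltn_ord k) cm sm.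
rewrite (derive1_mulr _ slope) (derive1_mulr _ slope) /hs_dil /hs_x /hs_y; ring.
Qed.

Let dil_sum i := \sum_(k < n | (k < i)%N) hs_dil k.
Let cos_prod i := \prod_(1 <= k < i) cos (theta (n - k)%N).

Lemma dil_sumS (i : 'I_n) : dil_sum i.+1 = dil_sum i + hs_dil i.
Proof.
rewrite /dil_sum (bigD1 i) ?ltnSn //= addrC; congr (_ + _).
by apply: eq_bigl => k; rewrite ltnS [RHS]ltn_neqAle andbC.
Qed.

Lemma cos_sin_neq0 i : (1 <= i < n)%N ->
  cos (theta (n - i)%N) != 0 /\ sin (theta (n - i)%N) != 0.
Proof. by move=> i_n; have [_] := reg; apply; lia. Qed.

Lemma cos_prod_neq0 i : (i <= n)%N -> cos_prod i != 0.
Proof.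
move=> i_n; rewrite /cos_prod prodf_seq_neq0; apply/allP => k.
rewrite mem_index_iota => /andP[k1 ki] /=.
by have [|//] := @cos_sin_neq0 k; lia.
Qed.

Lemma cos_prodS i : (1 <= i)%N ->
  cos_prod i.+1 = cos_prod i * cos (theta (n - i)%N).
Proof. by move=> i1; rewrite /cos_prod big_nat_recr. Qed.

Lemma hs_ptheta_slope (i : 'I_n) : (1 <= i)%N ->
  hs_ptheta r theta p (n - i) = hs_dil i / tan (theta (n - i)%N)
    - tan (theta (n - i)%N) * dil_sum i.
Proof.
move=> i1; have i_n := ltn_ord i; rewrite hs_ptheta_radial; last by lia.
have ni : (n - (n - i) = i)%N by lia.
rewrite (bigID (fun k : 'I_n => (k < i)%N)) /= addrC; congr (_ + _).
  rewrite (bigD1 i) ?ltnn //= big1 => [|k /andP[ki k_i]]; last first.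
    rewrite /hs_slope ni (negPf ki) (_ : (k == i :> nat) = false) ?mul0r //.
    exact: negPf.
  by rewrite addr0 /hs_slope ni ltnn eqxx mulrC.
rewrite /dil_sum mulr_sumr -sumrN; apply: eq_bigr => k ki.
by rewrite /hs_slope ni ki mulNr.
Qed.

Notation z := (row_mx (hs_q n r theta) p).
Variable C : R.

Lemma coord_hs (k : 'I_n) : [/\ coord_x k z = hs_x k, coord_y k z = hs_y k,
  coord_a k z = hs_a k & coord_b k z = hs_b k].
Proof.
rewrite /coord_x /coord_y /coord_a /coord_b !row_mxEl !row_mxEr.
by split=> //; rewrite /hs_q ?row_mxEl ?row_mxEr mxE.
Qed.

Lemma moment_angmom_hs k :
  moment_angmom C k z = hs_ang k + C / 2 * hs_rad n k.+1 r theta ^+ 2.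
Proof.
have [xE yE aE bE] := coord_hs k.
rewrite /moment_angmom /angmom /canon_a /canon_b !fctE xE yE aE bE /hs_ang.
rewrite -[X in _ = _ + _ * X]mulr1 -(cos2Dsin2 (theta (n + k)%N)) /hs_x /hs_y.
by ring.
Qed.

Lemma moment_angmom_angular (k : 'I_n) : (1 <= k)%N ->
  moment_angmom C k z = tildeI_angular n C k.+1 r theta (hs_ptheta r theta p).
Proof.
move=> k1; rewrite moment_angmom_hs /tildeI_angular addSn subn1 /= addnC.
rewrite hs_ptheta_angle hs_radE // (_ : (k == 0 :> nat) = false); last by lia.
by rewrite subnSK // addn1 subnSK // !exprMn prodrXl !mulrA.
Qed.

Variable o : 'I_n.
Hypothesis o0 : o = 0%N :> nat.

(** The recursion for [varrho] telescopes: by [hs_ptheta_slope], each step adds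
    one dilation to the sum and one cosine to the product, by
    cos^2 + sin^2 = 1. *)
Lemma varrhoE i : (i < n)%N -> varrho n i theta (hs_ptheta r theta p) =
  cos_prod i.+1 * dil_sum i.+1 - hs_dil o / cos_prod i.+1.
Proof.
elim: i => [|i IH] i_n.
  rewrite /= /cos_prod big_geq // mul1r invr1 mulr1 /dil_sum (bigD1 o) ?o0 //=.
  rewrite big1 => [|k /andP[k0]]; last by rewrite -val_eqE /= o0; lia.
  by rewrite addr0 subrr.
have -> : varrho n i.+1 theta (hs_ptheta r theta p) =
    hs_ptheta r theta p (n - i.+1) * sin (theta (n - i.+1)%N) * cos_prod i.+1 +
    (cos (theta (n - i.+1)%N))^-1 * varrho n i theta (hs_ptheta r theta p) by [].
rewrite IH; last exact: ltnW.
have := @hs_ptheta_slope (Ordinal i_n) isT; have := dil_sumS (Ordinal i_n).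
rewrite /= => -> ->; rewrite (@cos_prodS i.+1) //.
have [|cm sm] := @cos_sin_neq0 i.+1; first by lia.
have := @cos_prod_neq0 i.+1 (ltnW i_n).
have := cos2Dsin2 (theta (n - i.+1)%N); rewrite /tan; move: cm sm.
generalize (cos (theta (n - i.+1)%N)) (sin (theta (n - i.+1)%N)).
generalize (cos_prod i.+1) (dil_sum i.+1) (hs_dil (Ordinal i_n)) (hs_dil o).
move=> P D e d c s c0 s0 cs P0.
apply: subr0_eq; rewrite [LHS](_ : _ = P * D / c * (1 - (c ^+ 2 + s ^+ 2))).
  by rewrite cs subrr mulr0.
by field; rewrite c0 s0 P0.
Qed.

(** The phase exp(i (phi_o + phi_k)) is a common factor of z_o w_k and z_k w_o.
    The vector potential cancels in the difference, since it adds to each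
    w_j the same multiple of z_j. *)
Lemma moment_minor_hs k : moment_minor C o k z =
  (hs_rad n k.+1 r theta *
     (cos (theta (n + o)%N) * hs_b o - sin (theta (n + o)%N) * hs_a o) -
   hs_rad n o.+1 r theta *
     (cos (theta (n + k)%N) * hs_b k - sin (theta (n + k)%N) * hs_a k)) ^+ 2 +
  (hs_rad n o.+1 r theta *
     (cos (theta (n + k)%N) * hs_a k + sin (theta (n + k)%N) * hs_b k) -
   hs_rad n k.+1 r theta *
     (cos (theta (n + o)%N) * hs_a o + sin (theta (n + o)%N) * hs_b o)) ^+ 2.
Proof.
have [xk yk ak bk] := coord_hs k; have [xo yo ao bo] := coord_hs o.
rewrite /moment_minor /sqminor /minor_re /minor_im /canon_a /canon_b !fctE.
rewrite xk yk ak bk xo yo ao bo /hs_x /hs_y.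
have := cos2Dsin2 (theta (n + k)%N); have := cos2Dsin2 (theta (n + o)%N).
generalize (cos (theta (n + k)%N)) (sin (theta (n + k)%N)).
generalize (cos (theta (n + o)%N)) (sin (theta (n + o)%N)).
generalize (hs_rad n k.+1 r theta) (hs_rad n o.+1 r theta).
generalize (hs_a o) (hs_b o) (hs_a k) (hs_b k).
move=> a0 b0 a b rk r0 c0 s0 c s cs0 cs.
apply: subr0_eq; rewrite [LHS](_ : _ =
  (r0 ^+ 2 * (a ^+ 2 + b ^+ 2) - rk ^+ 2 * (a0 ^+ 2 + b0 ^+ 2)) *
  ((c0 ^+ 2 + s0 ^+ 2) - (c ^+ 2 + s ^+ 2))); last by ring.
by rewrite cs cs0 subrr mulr0.
Qed.

Lemma tan_neq0 i : (1 <= i < n)%N -> tan (theta (n - i)%N) != 0.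
Proof.
by move=> /cos_sin_neq0[c s]; rewrite /tan mulf_neq0 // invr_neq0.
Qed.

Lemma hs_rad_o : hs_rad n o.+1 r theta = r * \prod_(1 <= j < n) cos (theta j).
Proof. by rewrite hs_radE // o0 subn0 mulr1. Qed.

Lemma prod_cos_rev i : (i < n)%N ->
  \prod_(1 <= j < n) cos (theta j) =
    (\prod_(1 <= j < n - i) cos (theta j)) * cos_prod i.+1.
Proof.
elim: i => [|i IH] i_n.
  by rewrite subn0 (_ : cos_prod 1 = 1) ?mulr1 // /cos_prod big_geq.
rewrite IH; last exact: ltnW.
rewrite (@cos_prodS i.+1) // mulrA mulrAC; congr (_ * _).
by rewrite -(subnSK (ltnW i_n)) big_nat_recr //=; lia.
Qed.

Lemma hs_rad_neq0 (k : 'I_n) : hs_rad n k.+1 r theta != 0.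
Proof.
have [r0 csn] := reg; rewrite hs_radE //.
apply: mulf_neq0; first apply: mulf_neq0; first by rewrite gt_eqF.
  rewrite prodf_seq_neq0; apply/allP => j; rewrite mem_index_iota => /andP[j1 jn].
  by have [|//] := csn j; lia.
case: ifPn => [_|k0]; first exact: oner_neq0.
by have [|//] := csn (n - k)%N; have := ltn_ord k; lia.
Qed.

(** The common factors of the two radii, the cosines of the first [n - k - 1]
    angles, cancel. *)
Lemma hs_rad_ratio (k : 'I_n) : (1 <= k)%N ->
  hs_rad n k.+1 r theta =
    hs_rad n o.+1 r theta * (tan (theta (n - k)%N) / cos_prod k).
Proof.
move=> k1; have k_n := ltn_ord k.
rewrite hs_rad_o (prod_cos_rev k_n) cos_prodS // hs_radE //.
rewrite (_ : (k == 0 :> nat) = false); last by lia.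
have [|cn0 _] := @cos_sin_neq0 k; first by lia.
have := @cos_prod_neq0 k (ltnW k_n); rewrite /tan; move: cn0.
generalize (cos (theta (n - k)%N)) (cos_prod k) => c P c0 P0.
by field; rewrite c0 P0.
Qed.

Lemma hs_ptheta_o : hs_ptheta r theta p n = hs_ang o.
Proof. by rewrite -hs_ptheta_angle o0 addn0. Qed.

Lemma moment_minor_tilde (k : 'I_n) : (1 <= k)%N ->
  moment_minor C o k z = tildeI_pair n k r theta (hs_ptheta r theta p).
Proof.
move=> k1; have k_n := ltn_ord k.
rewrite moment_minor_hs /tildeI_pair prodfV -/(cos_prod k) hs_ptheta_angle.
have vE := @varrhoE k.-1 (leq_ltn_trans (leq_pred k) k_n).
rewrite hs_ptheta_o hs_ptheta_slope // vE prednK //.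
rewrite /hs_ang /hs_dil /hs_x /hs_y (hs_rad_ratio k1).
have := tan_neq0 (i := k); rewrite k1 k_n => /(_ isT).
have := @cos_prod_neq0 k (ltnW k_n); have := hs_rad_neq0 o.
generalize (cos (theta (n + k)%N)) (sin (theta (n + k)%N)).
generalize (cos (theta (n + o)%N)) (sin (theta (n + o)%N)).
generalize (hs_rad n o.+1 r theta) (tan (theta (n - k)%N)) (cos_prod k).
generalize (hs_a o) (hs_b o) (hs_a k) (hs_b k) (dil_sum k).
move=> a0 b0 a b D r0 t P c0 s0 c s r0_neq0 P_neq0 t_neq0.
congr (_ ^+ 2 + _ ^+ 2); field; rewrite ?P_neq0 ?t_neq0 //.
Qed.

(** [tildeI_base] is the case [k] = 1 of [tildeI_pair] with the first square
    expanded, by 1 / cos^2 = 1 + tan^2 and 1 / sin^2 = 1 + 1 / tan^2. *)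
Lemma moment_minor_base (k : 'I_n) : k = 1%N :> nat ->
  moment_minor C o k z = tildeI_base n r theta (hs_ptheta r theta p).
Proof.
move=> k1; rewrite moment_minor_tilde ?k1 // /tildeI_pair /tildeI_base.
rewrite !big_geq // /= !mulr1 mul0r addr0.
have [|c0 s0] := @cos_sin_neq0 1; first by have := ltn_ord k; lia.
rewrite /tan; have := cos2Dsin2 (theta (n - 1)%N); move: c0 s0.
generalize (hs_ptheta r theta p n) (hs_ptheta r theta p (n + 1)).
generalize (hs_ptheta r theta p (n - 1)).
generalize (cos (theta (n - 1)%N)) (sin (theta (n - 1)%N)).
move=> c s q l0 l1 c0 s0 cs.
apply: subr0_eq; rewrite [LHS](_ : _ =
  (l0 ^+ 2 / c ^+ 2 + l1 ^+ 2 / s ^+ 2) * (c ^+ 2 + s ^+ 2 - 1)).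
  by rewrite cs subrr mulr0.
by field; rewrite c0 s0.
Qed.

Lemma moment_angmom_first :
  moment_angmom C o z = tildeI_first n C r theta (hs_ptheta r theta p).
Proof.
by rewrite moment_angmom_hs /tildeI_first hs_ptheta_o hs_rad_o exprMn prodrXl !mulrA.
Qed.

End Hyperspherical.

Theorem theorem3p2 (R : realType) (n : nat) (C : R) (hn : (1 <= n)%N) :
  [/\ ((n <= 2)%N -> liouville_integrable (@LR_poisson R n C) (@HC R n)),
      ((3 <= n)%N -> nc_integrable (@LR_poisson R n C) (@HC R n)) &
      exists I J : nat -> 'rV[R]_((n + n) + (n + n)) -> R,
        let integrals := [seq I i | i <- iota 0 (2 * n)] ++
                         [seq J k | k <- iota 2 (n - 2)] in
        let F := lie_generated (@LR_poisson R n C) [set` integrals] in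
        [/\ [/\ I 0%N = @HC R n,
                hs_expr (I 1%N) (tildeI_first n C),
                (forall i, (1 < i <= n)%N ->
                   hs_expr (I i) (tildeI_angular n C i)),
                ((2 <= n)%N -> hs_expr (I n.+1) (@tildeI_base R n)) &
                (forall i, (1 < i < n)%N ->
                   hs_expr (I (n + i)%N) (@tildeI_pair R n i))],
            (forall k, (1 < k < n)%N ->
               J k = bracket (@LR_poisson R n C) (I n.+1) (I (n + k)%N)),
            ((n <= 2)%N -> commutative_algebra (@LR_poisson R n C) F),
            ((3 <= n)%N ->
               size integrals = (3 * n - 2)%N /\ is_ddim F (3 * n - 2)) &
            [/\ forall f, f \in integrals ->
                  first_integral (@LR_poisson R n C) (@HC R n) f,
                generically_independent integrals &
                complete_algebra (@LR_poisson R n C) (@HC R n) F]]].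
Proof.
case: n hn => [//|m] _.
pose F := lie_generated (@LR_poisson R m.+1 C) [set` integrals m C].
have [ddimF FI indep complete] := reduced_integrals_complete m C.
have comm : (m.+1 <= 2)%N -> commutative_algebra (@LR_poisson R m.+1 C) F.
  move=> m2; have [regI _ _ _] := center_integrals_commute m C.
  apply: (lie_generated_commutative (@L_const R _ C) (@L_antisym R _ C)) => //.
  exact: integrals_commute.
have sz : (3 <= m.+1)%N -> size (integrals m C) = (3 * m.+1 - 2)%N.
  by move=> m3; rewrite /integrals size_cat !size_map !size_iota; lia.
split.
- by move=> /comm Fcomm; exists F.
- by move=> _; exists F.
exists (integral_I (m := m) C), (integral_J (m := m) C) => /=.
split.
- split.
  + by [].
  + move=> r theta p reg; rewrite /integral_I /=.
    by apply: moment_angmom_first => //; rewrite inordK.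
  + move=> i /andP[i1 i_n] r theta p reg; rewrite /integral_I i_n.
    rewrite (_ : (i == 0%N) = false); last by lia.
    have := @moment_angmom_angular R m.+1 r theta p C (inord i.-1).
    by rewrite inordK ?prednK; [apply|..]; lia.
  + move=> m2 r theta p reg; rewrite /integral_I /= ltnn subSnn.
    by apply: moment_minor_base => //; rewrite inordK.
  + move=> i /andP[i1 i_n] r theta p reg; rewrite /integral_I.
    rewrite (_ : (m.+1 + i <= m.+1)%N = false) /=; last by lia.
    rewrite addKn.
    have := @moment_minor_tilde R m.+1 r theta p reg C ord0 erefl (inord i).
    by rewrite inordK //; apply; lia.
- move=> k /andP[k1 k_n]; rewrite /integral_J /integral_I /= ltnn subSnn.
  by rewrite (_ : (m + k < m.+1)%N = false) /= ?addSn ?subSS ?addKn //; lia.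
- exact: comm.
- by move=> m3; split; [exact: sz|rewrite -sz].
- by split.
Qed.
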